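(* Let $r\geq 4$ and let $\mathfrak{b}$ be a Borel subalgebra of the complex orthogonal Lie algebra $\mathfrak{o}_{2r}$ (simple of type $D_r$). For every integer $m\ge 0$, the number of abelian ideals of $\mathfrak{b}$ of dimension $m$ is equal to the coefficient of $t^m$ in the polynomial $$f_{D_r}(t)=t^{2r-2}+\sum_{k=0}^{r-2}t^{2r-k-3}\prod_{j=1}^{k}(1+t^j)+\prod_{j=1}^{r-1}(1+t^j).$$
   Context: An abelian ideal of $\mathfrak{b}$ is an ideal $I$ of the Lie algebra $\mathfrak{b}$ with $[I,I]=0$ (the zero ideal is included); dimension is over $\mathbb{C}$. An empty product equals $1$. *)

(* Defs.v *)
From mathcomp Require Import all_boot all_order all_algebra.

Set Implicit Arguments.
Unset Strict Implicit.
Unset Printing Implicit Defensive.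

Import GRing.Theory.
Local Open Scope ring_scope.

Section MatrixLieAlgebra.
Variables (F : fieldType) (n : nat).
Implicit Types (A B : 'M[F]_n) (U V W g b I : {vspace 'M[F]_n}).

Definition lie_bracket A B : 'M[F]_n := A *m B - B *m A.

(* The span [U, V] of all brackets of elements of U and V; it is independent
   of the bases used here, see memv_lie and lie_subv. *)
Definition lie_space U V : {vspace 'M[F]_n} :=
  <<[seq lie_bracket A B | A <- vbasis U, B <- vbasis V]>>%VS.

Definition lie_subalgebra g : Prop := (lie_space g g <= g)%VS.

Definition derived_series (k : nat) g : {vspace 'M[F]_n} :=
  iter k (fun V => lie_space V V) g.

Definition lie_solvable g : Prop := exists k, derived_series k g = 0%VS.

Definition lie_ideal b I : Prop := (I <= b)%VS /\ (lie_space b I <= I)%VS.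

Definition lie_abelian I : Prop := lie_space I I = 0%VS.

Definition abelian_ideal b I : Prop := lie_ideal b I /\ lie_abelian I.

Definition solvable_subalgebra g b : Prop :=
  [/\ (b <= g)%VS, lie_subalgebra b & lie_solvable b].

Definition borel_subalgebra g b : Prop :=
  solvable_subalgebra g b /\
  forall c, solvable_subalgebra g c -> (b <= c)%VS -> c = b.

(* o_n: the skew-symmetric matrices, as the kernel of A |-> A^T + A. *)
Definition orthogonal_lie : {vspace 'M[F]_n} := lker (linfun (trmx \+ idfun)).

Lemma memv_orthogonal_lie A : (A \in orthogonal_lie) = (A^T == - A).
Proof. by rewrite memv_ker lfunE /= addr_eq0. Qed.

Lemma memv_lie U V A B :
  A \in U -> B \in V -> lie_bracket A B \in lie_space U V.
Proof.
move=> /coord_vbasis -> /coord_vbasis ->; rewrite /lie_bracket.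
rewrite mulmx_suml mulmx_sumr -sumrB memv_suml // => i _.
rewrite mulmx_sumr mulmx_suml -sumrB memv_suml // => j _.
rewrite -!(scalemxAl, scalemxAr) !scalerA [X in _ - X *: _]mulrC.
rewrite -scalerBr memvZ //.
by apply/memv_span/allpairs_f; apply: mem_nth; rewrite size_tuple.
Qed.

Lemma lie_subv U V W :
  reflect (forall A B, A \in U -> B \in V -> lie_bracket A B \in W)
          (lie_space U V <= W)%VS.
Proof.
apply: (iffP idP) => [sUVW A B AU BV | UVW].
  exact: subvP sUVW _ (memv_lie AU BV).
by apply/span_subvP=> _ /allpairsP[[A B] /= [/vbasis_mem AU /vbasis_mem BV ->]];
  apply: UVW.
Qed.

End MatrixLieAlgebra.

Arguments orthogonal_lie F n : clear implicits.

Definition f_D (r : nat) : {poly nat} :=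
  'X^(2 * r - 2)
  + \sum_(0 <= k < r.-1) 'X^(2 * r - k - 3) * \prod_(1 <= j < k.+1) (1 + 'X^j)
  + \prod_(1 <= j < r) (1 + 'X^j).

(* Main.v *)
Require Import Defs.
From HB Require Import structures.
From mathcomp Require Import all_boot all_order all_algebra.
From mathcomp Require Import boolp ring zify.

Set Implicit Arguments.
Unset Strict Implicit.
Unset Printing Implicit Defensive.

Import Order.TTheory GRing.Theory Num.Theory.
Local Open Scope ring_scope.

(** A solvable algebra [b] of skew matrices of size [2r] stabilises a flag of
    isotropic subspaces of dimensions up to [r]: Lie's theorem ([lie_mod]) gives
    weight vectors in the orthogonal of an isotropic subspace modulo this
    subspace, and they can be made isotropic ([isotropic_eigenvector]). Completing
    the flag by a dual isotropic family, [b] consists of matrices with blocks [L],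
    [0] above [c], [- L^T], where [L] is lower triangular and [c] is skew. All of
    these form a solvable algebra, so a Borel subalgebra is exactly of this shape
    ([borel_conjugate]), and the entries of [L] and [c] are the coordinates for the
    diagonal and the positive roots [e_i - e_j] and [e_i + e_j], [i < j < r].

    An abelian ideal is stable under the diagonal matrices, hence spanned by its
    weight components ([ideal_delta]), and it has no diagonal part ([ideal_diag]).
    So abelian ideals correspond to sets [S], of the same size, of positive roots
    that are stable under adding positive roots and in which no two members add up
    to a root ([abelian_upset]).

    Put [m = r - 1] for the last index. The upper sets of the roots [e_i + e_j] with
    [a <= i < j < b] are strict partitions with parts less than [b - a], with
    generating function the product of the [1 + t^j] for [1 <= j < b - a]
    ([card_gf_stair]). If [S] does not contain [e_0 - e_m], it contains no
    difference, and is such a set for all indices; this gives the last product. If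
    [S] contains both [e_0 - e_m] and [e_0 + e_m], let [p] be least with [e_0 - e_p]
    in [S]. Then [S] consists of the [2r - 1 - p] roots [e_0 - e_i], [p <= i], and [e_0 + e_j],
    and of an upper set of sums for the indices from [1] to [p - 1]; this gives
    [t^(2r-2)] for [p = 1] and the summand [k = p - 2] otherwise. If [S] contains
    [e_0 - e_m] but not [e_0 + e_m], changing the sign of [e_m] turns it into an
    upper set of sums whose first row is full; this gives the summand
    [k = r - 2]. *)

(** * Lie's theorem modulo an invariant subspace *)

Section Lie.
Variables (K : numClosedFieldType) (N : nat).
Implicit Types (A B H U W : 'M[K]_N) (g h : {vspace 'M[K]_N}).

Lemma submxB m (u v : 'M[K]_(m, N)) U :
  (u <= U)%MS -> (v <= U)%MS -> (u - v <= U)%MS.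
Proof. by move=> uU vU; rewrite addmx_sub ?eqmx_opp. Qed.

Lemma lie_space_mono g h :
  (g <= h)%VS -> (lie_space g g <= lie_space h h)%VS.
Proof.
by move=> /subvP gh; apply/lie_subv => A B Ag Bg; apply: memv_lie; apply: gh.
Qed.

Lemma derived_series_mono k g h :
  (g <= h)%VS -> (derived_series k g <= derived_series k h)%VS.
Proof. by move=> gh; elim: k => //= k IH; apply: lie_space_mono. Qed.

Lemma lie_solvable_sub g h : (g <= h)%VS -> lie_solvable h -> lie_solvable g.
Proof.
move=> gh [k hk]; exists k; apply/eqP.
by rewrite -subv0 -hk; apply: derived_series_mono.
Qed.

Lemma lie_solvable_proper g :
  lie_solvable g -> (g <= lie_space g g)%VS -> g = 0%VS.
Proof.
move=> [k gk] sg; apply/eqP; rewrite -subv0 -gk.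
by elim: k {gk} => //= k IH; apply: (subv_trans sg); apply: lie_space_mono.
Qed.

(** [A] acts on the quotient of [P] by [U], where some product of factors
    [A - z] vanishes by Cayley-Hamilton. Applying these factors to [w] one at a
    time, the last vector before falling into [U] is the eigenvector. Taking [P]
    to be a predicate spares writing a simultaneous weight space as the row
    space of a matrix. *)
Lemma eigenvector_mod A U (P : 'rV[K]_N -> Prop) (w : 'rV[K]_N) :
    (forall v l, P v -> P (v *m (A - l%:M))) -> P w -> ~~ (w <= U)%MS ->
  exists v l, [/\ P v, ~~ (v <= U)%MS & (v *m (A - l%:M) <= U)%MS].
Proof.
move=> PA Pw wU.
have [s ws] : exists s, (w *m \prod_(z <- s) (A - z%:M) <= U)%MS.
  case: N A U P w PA Pw wU => [|n] A U P w PA Pw wU.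
    by case/negP: wU; rewrite thinmx0 sub0mx.
  have [s cs] := closed_field_poly_normal (char_poly A).
  exists s; rewrite (_ : \prod_(z <- s) _ = horner_mx A (char_poly A)).
    by rewrite Cayley_Hamilton mulmx0 sub0mx.
  rewrite cs (monicP (char_poly_monic A)) scale1r rmorph_prod /=.
  by apply: eq_bigr => z _; rewrite rmorphB /= horner_mx_X horner_mx_C.
elim: s w Pw wU ws => [|z s IH] w Pw wU.
  by rewrite big_nil mulmx1 (negPf wU).
rewrite big_cons mulmxA => ws.
have [wz|wz] := boolP (w *m (A - z%:M) <= U)%MS; first by exists w, z.
by apply: IH ws => //; apply: PA.
Qed.

(** Throughout this section [w] has weight [lam] modulo [U] for an ideal [h],
    and [A] normalises [h]. *)
Section Weight.
Variables (U A : 'M[K]_N) (h : {vspace 'M[K]_N}) (w : 'rV[K]_N) (lam : 'M[K]_N -> K).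
Hypotheses (UA : stablemx U A) (Uh : forall H, H \in h -> stablemx U H).
Hypothesis hA : forall H, H \in h -> lie_bracket A H \in h.
Hypothesis wU : ~~ (w <= U)%MS.
Hypothesis wh : forall H, H \in h -> (w *m (H - (lam H)%:M) <= U)%MS.

Let wA k := iter k (mulmxr A) w.
(** The span of [U] and [w], [w A], ..., [w A^(k-1)]. *)
Fixpoint krylov k : 'M[K]_N :=
  if k is k'.+1 then (krylov k' + iter k' (mulmxr A) w)%MS else U.

Lemma krylov_sub k l : (k <= l)%N -> (krylov k <= krylov l)%MS.
Proof.
move=> /subnK <-; elim: (l - k)%N => //= m IH.
by apply: submx_trans IH _; rewrite addsmxSl.
Qed.

Lemma krylovA k : (krylov k *m A <= krylov k.+1)%MS.
Proof.
elim: k => [|k IH] /=; first by apply: submx_trans UA _; rewrite addsmxSl.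
rewrite addsmxMr addsmx_sub; apply/andP; split.
  by apply: submx_trans IH _; rewrite addsmxSl.
by rewrite addsmxSr.
Qed.

(** Commuting [H] past [k] copies of [A] gives [w A^k H = w H A^k + ...], where
    each of the [k] correction terms is [lam [A, H]] times [w A^(k-1)] up to
    lower Krylov vectors, because [[A, H]] lies in [h]. At [k = 0] the
    coefficient [k] vanishes and the value of [k.-1] does not matter. *)
Lemma krylov_weight2 k H : H \in h ->
  (wA k *m (H - (lam H)%:M)
    - (k%:R * lam (lie_bracket A H)) *: wA k.-1 <= krylov k.-1)%MS /\
  (wA k *m (H - (lam H)%:M) <= krylov k)%MS.
Proof.
elim: k H => [|k IH] H Hh.
  by rewrite mul0r scale0r subr0; split; apply: wh.
have [IH1 _] := IH H Hh; have [_ IH2] := IH _ (hA Hh).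
suff S1 : (wA k.+1 *m (H - (lam H)%:M)
    - (k.+1%:R * lam (lie_bracket A H)) *: wA k <= krylov k)%MS.
  split=> //; set c := k.+1%:R * _ in S1.
  rewrite -[X in (X <= _)%MS](subrK (c *: wA k)).
  apply: addmx_sub; first by apply: submx_trans S1 (krylov_sub _).
  by apply: scalemx_sub; rewrite /= addsmxSr.
have -> : wA k.+1 *m (H - (lam H)%:M)
    - (k.+1%:R * lam (lie_bracket A H)) *: wA k =
   (wA k *m (H - (lam H)%:M) - (k%:R * lam (lie_bracket A H)) *: wA k.-1) *m A
   + wA k *m (lie_bracket A H - (lam (lie_bracket A H))%:M)
   + (k%:R * lam (lie_bracket A H)) *: (wA k.-1 *m A - wA k).
  rewrite /wA iterS /= -/(wA k) -/(wA k.-1) {1}/lie_bracket.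
  move: (lam _) (lam _) => l m.
  rewrite !(mulmxBl, mulmxBr) !mul_mx_scalar -!scalemxAl !mulmxA -natr1.
  move: (wA k *m A *m H) (wA k *m H *m A) (wA k *m A) (wA k.-1 *m A) (wA k).
  by move=> a e f x y; apply/matrixP=> i j; rewrite !mxE; ring.
apply: addmx_sub; first apply: addmx_sub => //.
  apply: submx_trans (submxMr _ IH1) _.
  by case: (k) => [|k'] //; apply: krylovA.
case: (k) => [|k'] /=; last by rewrite subrr scaler0 sub0mx.
by rewrite mul0r scale0r sub0mx.
Qed.

Lemma krylov_weight_sub k H : H \in h ->
  (krylov k.+1 *m (H - (lam H)%:M) <= krylov k)%MS.
Proof.
move=> Hh.
have kk l : (krylov l *m (H - (lam H)%:M) <= krylov l)%MS.
  elim: l => [|l IH] /=.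
    rewrite mulmxBr; apply: submxB; first exact: Uh.
    by rewrite mul_mx_scalar scalemx_sub.
  rewrite addsmxMr addsmx_sub (submx_trans IH) ?addsmxSl //=.
  have [_ W] := krylov_weight2 l Hh.
  exact: submx_trans W (addsmxSl _ _).
rewrite /= addsmxMr addsmx_sub kk /=.
by have [] := krylov_weight2 k Hh.
Qed.

Lemma krylov_stop : exists k, (wA k <= krylov k)%MS.
Proof.
apply: contrapT => /forallNP nk.
have rk k : (k <= \rank (krylov k))%N.
  elim: k => // k IH; apply: (leq_ltn_trans IH); apply: rank_ltmx.
  rewrite /ltmx /= addsmxSl /=; apply/negP=> le; apply: (nk k).
  by apply: submx_trans le; rewrite addsmxSr.
by have := leq_trans (rk N.+1) (rank_leq_row _); rewrite ltnn.
Qed.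

(** Let [d + 1] be the least exponent such that [w A^(d+1)] depends on the
    earlier Krylov vectors. [H - lam H] maps [krylov (d+1)] into [krylov d], so by
    [krylov_weight2] the vector [(d + 1) lam [A, H] w A^d] lies in [krylov d];
    minimality of [d] and characteristic 0 give the vanishing. This replaces the
    usual trace argument. *)
Lemma weight_bracket H : H \in h -> lam (lie_bracket A H) = 0.
Proof.
move=> Hh; have ex := krylov_stop.
case: (ex_minnP ex) => -[|d] wd dmin; first by rewrite (negPf wU) in wd.
have wdN : ~~ (wA d <= krylov d)%MS.
  by apply/negP => /dmin; rewrite ltnn.
have [W1 _] := krylov_weight2 d.+1 Hh.
have W2 := submx_trans (submxMr (H - (lam H)%:M) wd) (krylov_weight_sub d Hh).
apply/eqP; apply: contraNT wdN => l0.
have dl0 : d.+1%:R * lam (lie_bracket A H) != 0 by rewrite mulf_neq0 ?pnatr_eq0.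
rewrite -[wA d](scalerK dl0); apply: scalemx_sub.
by have := submxB W2 W1; rewrite opprB addrC subrK.
Qed.
End Weight.

(** Lie's theorem for the quotient [W / U], by induction on [dim g]: a weight
    vector of an ideal [h] of codimension 1 spans, by [weight_bracket], a
    [g]-stable weight space of [h], and any eigenvector in it of an element
    outside [h] is a weight vector of [g]. The relative form is what the
    construction of isotropic flags needs. *)
Theorem lie_mod (U W : 'M[K]_N) g :
    lie_subalgebra g -> lie_solvable g ->
    (forall A, A \in g -> stablemx U A) -> (forall A, A \in g -> stablemx W A) ->
    ~~ (W <= U)%MS ->
  exists (v : 'rV[K]_N) (lam : 'M[K]_N -> K), [/\ (v <= W)%MS, ~~ (v <= U)%MS &
    forall A, A \in g -> (v *m (A - (lam A)%:M) <= U)%MS].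
Proof.
move=> + + + + WU.
elim/ltn_ind: {g}(\dim g) {-2}g (erefl (\dim g)) => n IH g dg sg solg Ug Wg.
have [g0|g0] := eqVneq g 0%VS.
  have [i Wi] := row_subPn WU.
  exists (row i W), (fun=> 0); split=> //; first exact: row_sub.
  by move=> A; rewrite g0 memv0 => /eqP->; rewrite raddf0 subr0 mulmx0 sub0mx.
have /subvPn[A Ag AD] : ~~ (g <= lie_space g g)%VS.
  by apply: contra_neqN g0 => /(lie_solvable_proper solg).
(* a hyperplane of g that contains [g, g] and avoids A: it is an ideal *)
pose h := (lie_space g g + (g :\: (lie_space g g + <[A]>)))%VS.
have hg : (h <= g)%VS by rewrite subv_add sg diffvSl.
have gh : (g <= h + <[A]>)%VS.
  rewrite -{1}(addv_diff_cap g (lie_space g g + <[A]>)%VS) subv_add.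
  rewrite (subv_trans _ (addvSl _ _)) ?addvSr //=.
  by rewrite (subv_trans (capvSr _ _)) // addvS // addvSl.
have dh : (\dim h < n)%N.
  have Xg : (lie_space g g + <[A]> <= g)%VS by rewrite subv_add sg -memvE.
  rewrite -dg -(dimv_cap_compl g (lie_space g g + <[A]>)%VS) (capv_idPr Xg).
  apply: leq_ltn_trans (dimv_add_leqif _ _).1 _; rewrite ltn_add2r.
  rewrite ltn_neqAle dimvS ?addvSl // andbT (dimv_leqif_eq (addvSl _ _)).2.
  by apply: contra AD => /eqP->; rewrite memvE addvSr.
have Dh : (lie_space g g <= h)%VS by rewrite addvSl.
have sh : lie_subalgebra h by apply: subv_trans Dh; apply: lie_space_mono.
have solh : lie_solvable h by apply: lie_solvable_sub solg.
have hgP H : H \in h -> H \in g by apply: subvP.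
have [v [lam [vW vU vh]]] := IH _ dh h erefl sh solh
  (fun B Bh => Ug B (hgP B Bh)) (fun B Bh => Wg B (hgP B Bh)).
have hA H : H \in h -> lie_bracket A H \in h.
  by move=> Hh; apply: (subvP Dh); apply: memv_lie => //; apply: hgP.
have lam0 H : H \in h -> lam (lie_bracket A H) = 0.
  by apply: (weight_bracket (U := U) (w := v)) => //; auto.
pose P (w : 'rV[K]_N) := (w <= W)%MS /\
  forall H, H \in h -> (w *m (H - (lam H)%:M) <= U)%MS.
have [||x [l [[xW xh] xU xA]]] := @eigenvector_mod A U P v _ _ vU.
- move=> w l [wW wh]; split=> [|H Hh].
    rewrite mulmxBr mul_mx_scalar submxB ?scalemx_sub //.
    exact: submx_trans (submxMr _ wW) (Wg _ Ag).
  have -> : w *m (A - l%:M) *m (H - (lam H)%:M) =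
     w *m (H - (lam H)%:M) *m (A - l%:M)
     + w *m (lie_bracket A H - (lam (lie_bracket A H))%:M).
    rewrite lam0 // raddf0 subr0 -mulmxA -[w *m _ *m _]mulmxA -mulmxDr.
    congr (_ *m _); rewrite /lie_bracket.
    rewrite !(mulmxBl, mulmxBr) !(mul_scalar_mx, mul_mx_scalar).
    move: (A *m H) (H *m A) => a b.
    by apply/matrixP=> i j; rewrite !mxE; case: (i == j); ring.
  apply: addmx_sub; last exact: wh (hA _ Hh).
  rewrite mulmxBr mul_mx_scalar submxB ?scalemx_sub ?wh //.
  by apply: submx_trans (submxMr _ (wh _ Hh)) (Ug _ Ag).
- by split.
have ex B : exists m, B \in g -> (x *m (B - m%:M) <= U)%MS.
  have [Bg|] := boolP (B \in g); last by exists 0.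
  have /memv_addP[H Hh [_ /vlineP[c ->] ->]] := subvP gh _ Bg.
  exists (lam H + c * l) => _.
  have -> : H + c *: A - (lam H + c * l)%:M = (H - (lam H)%:M) + c *: (A - l%:M).
    by apply/matrixP=> i j; rewrite !mxE; case: (i == j); ring.
  by rewrite mulmxDr -scalemxAr addmx_sub ?scalemx_sub ?xh.
have [mu xg] := choice ex.
by exists x, mu.
Qed.
End Lie.

(** * Flags of isotropic subspaces *)

Section Isotropic.
Variables (K : numClosedFieldType) (N : nat) (b : {vspace 'M[K]_N}).
Hypotheses (bo : (b <= orthogonal_lie K N)%VS) (sb : lie_subalgebra b)
  (solb : lie_solvable b).

Lemma orthogonalT A : A \in b -> A^T = - A.
Proof. by move=> /(subvP bo); rewrite memv_orthogonal_lie => /eqP. Qed.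

Lemma stable_orthogonal k (p : 'M[K]_(k, N)) A :
  A \in b -> (p *m A <= p)%MS -> stablemx (kermx p^T) A.
Proof.
move=> Ab /submxP[L pA]; rewrite sub_kermx.
have -> : kermx p^T *m A *m p^T = - (kermx p^T *m (p *m A)^T).
  by rewrite trmx_mul orthogonalT // mulNmx mulmxN opprK mulmxA.
by rewrite pA trmx_mul mulmxA mulmx_ker mul0mx oppr0.
Qed.

Lemma tr_dot (x y : 'rV[K]_N) : x *m y^T = y *m x^T.
Proof.
by rewrite -[LHS]trmxK trmx_mul trmxK [LHS]mx11_scalar mxE -mx11_scalar.
Qed.

(** Take a weight vector [v] of [b] in the orthogonal of [p] modulo [p]. If it is
    not isotropic, its weight is 0, as [(v A, v) = - (v, v A)]. By the bound on
    [k] there is then a second weight vector [w] orthogonal to [p] and [v]; if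
    [w] is not isotropic either, both are killed by [b] modulo [p], and so is
    every combination [v + c w], one of which is isotropic. *)
Lemma isotropic_eigenvector k (p : 'M[K]_(k, N)) :
    (k + k + 2 <= N)%N -> p *m p^T = 0 ->
    (forall A, A \in b -> (p *m A <= p)%MS) ->
  exists v : 'rV[K]_N, [/\ v *m p^T = 0, v *m v^T = 0, ~~ (v <= p)%MS &
    forall A, A \in b -> exists l, (v *m (A - l%:M) <= p)%MS].
Proof.
move=> kN pp pb.
have Ub A : A \in b -> stablemx <<p>>%MS A.
  move=> Ab; rewrite (eqmxMr A (genmxE p)) genmxE; exact: pb.
have big m (q : 'M[K]_(m, N)) : (m <= k.+1)%N -> ~~ (kermx q^T <= <<p>>)%MS.
  move=> mk; apply/negP => /mxrankS; rewrite mxrank_ker mxrank_tr genmxE.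
  have := rank_leq_row p; have := rank_leq_row q; lia.
have [v [lam [vp vU vb]]] := lie_mod sb solb Ub
  (fun A Ab => stable_orthogonal Ab (pb A Ab)) (big _ p (leqnSn k)).
move: vp vU vb; rewrite sub_kermx genmxE => /eqP vp vU vb.
have [vv|vv] := eqVneq (v *m v^T) 0.
  exists v; split=> // A Ab; exists (lam A); rewrite -(genmxE p); exact: vb.
pose q := col_mx p v.
have qb A : A \in b -> (q *m A <= q)%MS.
  move=> Ab; rewrite mul_col_mx col_mx_sub.
  have pq : (p <= q)%MS by rewrite -addsmxE addsmxSl.
  rewrite (submx_trans (pb A Ab) pq) /=.
  have := vb A Ab; rewrite genmxE mulmxBr mul_mx_scalar => h.
  rewrite -[v *m A](subrK (lam A *: v)); apply: addmx_sub.
    exact: submx_trans h pq.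
  by apply: scalemx_sub; rewrite -addsmxE addsmxSr.
have [|w [mu [wq wU wb]]] := lie_mod sb solb Ub
  (fun A Ab => stable_orthogonal Ab (qb A Ab)) (big _ q _); first by rewrite addn1.
move: wq wU wb; rewrite sub_kermx genmxE tr_col_mx mul_mx_row => wq wU wb.
have /eq_row_mx[wp wv] : row_mx (w *m p^T) (w *m v^T) = row_mx 0 0.
  by rewrite (eqP wq) row_mx0.
have [ww|ww] := eqVneq (w *m w^T) 0.
  exists w; split=> // A Ab; exists (mu A); rewrite -(genmxE p); exact: wb.
(* an anisotropic weight vector has weight 0 *)
have kill (x : 'rV[K]_N) l A : A \in b -> x *m p^T = 0 -> x *m x^T != 0 ->
    (x *m (A - l%:M) <= p)%MS -> (x *m A <= p)%MS.
  move=> Ab xp xx xA; suff l0 : l = 0 by rewrite l0 raddf0 subr0 in xA.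
  have /submxP[u xAu] := xA.
  have E : x *m A *m x^T = l *: (x *m x^T).
    have : x *m A = u *m p + l *: x.
      by rewrite -xAu mulmxBr mul_mx_scalar subrK.
    move=> ->; rewrite mulmxDl -scalemxAl -mulmxA.
    by rewrite -[p *m x^T]trmxK trmx_mul trmxK xp trmx0 mulmx0 add0r.
  have : x *m A *m x^T = - (x *m A *m x^T).
    by rewrite [LHS]tr_dot trmx_mul orthogonalT // mulNmx mulmxN mulmxA.
  move/eqP; rewrite -addr_eq0 E -mulr2n -scaler_nat scalerA scaler_eq0.
  by rewrite (negPf xx) orbF mulf_eq0 pnatr_eq0 /= => /eqP.
have pvb A : A \in b -> (v *m A <= p)%MS.
  by move=> Ab; apply: (kill v (lam A)); rewrite -?(genmxE p) ?vb.
have pwb A : A \in b -> (w *m A <= p)%MS.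
  by move=> Ab; apply: (kill w (mu A)); rewrite -?(genmxE p) ?wb.
have [e Ee] : exists e, w *m w^T = e%:M by eexists; apply: mx11_scalar.
have [d Ed] : exists d, v *m v^T = d%:M by eexists; apply: mx11_scalar.
have e0 : e != 0 by apply: contra_neq ww => e0; rewrite Ee e0 raddf0.
pose c := sqrtC (- d / e).
exists (v + c *: w); split.
- by rewrite mulmxDl -scalemxAl vp wp scaler0 addr0.
- rewrite linearD linearZ /= mulmxDl !mulmxDr -!scalemxAl -!scalemxAr.
  rewrite (tr_dot v w) wv !scaler0 addr0 add0r scalerA -expr2 sqrtCK.
  by rewrite Ed Ee scale_scalar_mx divfK // -raddfD /= subrr raddf0.
- apply: contra vv => /submxP[u vwu].
  have : (v + c *: w) *m v^T = 0.
    rewrite vwu -mulmxA -[p *m v^T]trmxK trmx_mul trmxK vp trmx0.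
    by rewrite mulmx0.
  by rewrite mulmxDl -scalemxAl wv scaler0 addr0 => ->.
- move=> A Ab; exists 0; rewrite raddf0 subr0 mulmxDl -scalemxAl.
  by rewrite addmx_sub ?scalemx_sub ?pvb ?pwb.
Qed.

Lemma isotropic_flag k : (k + k <= N)%N ->
  exists p : 'M[K]_(k, N), [/\ p *m p^T = 0, row_free p & forall A, A \in b ->
    exists2 L : 'M[K]_k,
      p *m A = L *m p & forall i j : 'I_k, (i < j)%N -> L i j = 0].
Proof.
elim: k => [|k IH] kN.
  exists 0; split=> [||A _].
  - by rewrite mul0mx.
  - by rewrite /row_free mxrank0.
  - by exists 0; [rewrite !mul0mx | case].
have [|p [pp pf pb]] := IH; first by lia.
have pb' A : A \in b -> (p *m A <= p)%MS.
  by move=> /pb[L -> _]; apply: submxMl.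
have [|v [vp vv vnp vb]] := isotropic_eigenvector _ pp pb'; first by lia.
rewrite -addn1; exists (col_mx p v); split=> [||A Ab].
- rewrite tr_col_mx mul_col_row pp vp vv.
  rewrite -[p *m v^T]trmxK trmx_mul trmxK vp trmx0.
  exact: block_mx0.
- rewrite /row_free eqn_leq rank_leq_row -addsmxE addn1.
  rewrite -{1}(eqP pf) rank_ltmx // /ltmx addsmxSl /=.
  by apply: contra vnp; apply: submx_trans; rewrite addsmxSr.
have [L pA Llow] := pb A Ab; have [l /submxP[u vA]] := vb A Ab.
exists (block_mx L 0 u l%:M).
  rewrite mul_col_mx mul_block_col pA mul0mx addr0; congr (col_mx _ _).
  by rewrite -vA mulmxBr mul_mx_scalar mul_scalar_mx subrK.
move=> i j; rewrite -[i]splitK -[j]splitK.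
case: (split i) => i'; case: (split j) => j' /= ij.
- by rewrite block_mxEul Llow.
- by rewrite block_mxEur mxE.
- by have := ltn_ord j'; move: ij => /=; lia.
- by move: ij; rewrite !ord1 ltnn.
Qed.

End Isotropic.

(** Any family [s^T] dual to [p] becomes isotropic after subtracting half of its
    Gram matrix times [p]. *)
Lemma dual_isotropic (K : numFieldType) r N (p : 'M[K]_(r, N)) :
  p *m p^T = 0 -> row_free p ->
  exists q : 'M[K]_(r, N), q *m p^T = 1%:M /\ q *m q^T = 0.
Proof.
move=> pp /row_freeP[s ps]; pose g := s^T *m s.
have sp : s^T *m p^T = 1%:M by rewrite -trmx_mul ps trmx1.
have gT : g^T = g by rewrite /g trmx_mul trmxK.
exists (s^T - 2^-1 *: g *m p); split.
  by rewrite mulmxBl -mulmxA pp mulmx0 subr0.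
rewrite linearB /= trmx_mul linearZ /= trmxK gT mulmxBl !mulmxBr -/g.
rewrite [s^T *m _]mulmxA sp mul1mx [2^-1 *: g *m p *m (_ *m _)]mulmxA.
rewrite -[X in _ - (_ - X *m _)]mulmxA pp mulmx0 mul0mx subr0.
rewrite -[X in _ - X]mulmxA ps mulmx1 -addrA -opprD -scalerDl.
rewrite (_ : 2^-1 + 2^-1 = 1) ?scale1r ?subrr //.
by rewrite -[LHS]mulr2n -[LHS]mulr_natr mulVf ?pnatr_eq0.
Qed.

(** * A solvability criterion *)

Lemma lie_space_ind (F : fieldType) n (T : 'M[F]_n -> Prop) (U V : {vspace 'M[F]_n}) :
    T 0 -> (forall A B, T A -> T B -> T (A + B)) ->
    (forall c A, T A -> T (c *: A)) ->
    (forall A B, A \in U -> B \in V -> T (lie_bracket A B)) ->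
  forall A, A \in lie_space U V -> T A.
Proof.
rewrite /lie_space; set s := [seq _ | A <- _, B <- _] => T0 TD TZ TB A.
move=> /(@coord_span _ _ _ (in_tuple s)) ->.
apply: (big_ind T) => // i _; apply: TZ.
have /allpairsP[[B C] /= [/vbasis_mem Bi /vbasis_mem Ci ->]] :=
  mem_nth 0 (ltn_ord i : (i < size s)%N).
exact: TB.
Qed.

(** In a basis ordered by [ht] the matrices of [g] are triangular; each derived
    algebra moves their support by at least one more step of [ht]. *)
Lemma triangular_solvable (F : fieldType) n (P Q : 'M[F]_n) (ht : 'I_n -> nat)
    (g : {vspace 'M[F]_n}) :
    Q *m P = 1%:M -> injective ht ->
    (forall A, A \in g -> forall i j, (ht i < ht j)%N -> (P *m A *m Q) i j = 0) ->
  lie_solvable g.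
Proof.
move=> QP hinj gtri.
have D k A : A \in derived_series k g ->
    forall i j, (ht i < ht j + k)%N -> (P *m A *m Q) i j = 0.
  elim: k A => [|k IH] A /=.
    by move=> Ag i j; rewrite addn0; apply: gtri.
  apply: (@lie_space_ind _ _ (fun C => forall i j,
    (ht i < ht j + k.+1)%N -> (P *m C *m Q) i j = 0))
    => {A} [|A B hA hB|c A hA|A B /IH hA /IH hB] i j ij.
  - by rewrite mulmx0 mul0mx mxE.
  - by rewrite mulmxDr mulmxDl mxE hA ?hB ?addr0.
  - by rewrite -scalemxAr -scalemxAl mxE hA ?mulr0.
  pose X := P *m A *m Q; pose Y := P *m B *m Q.
  have -> : P *m lie_bracket A B *m Q = X *m Y - Y *m X.
    have e C E : (P *m C *m Q) *m (P *m E *m Q) = P *m (C *m E) *m Q.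
      by rewrite -!mulmxA [Q *m (P *m _)]mulmxA QP mul1mx.
    by rewrite !e /lie_bracket mulmxBr mulmxBl.
  rewrite !mxE -sumrB big1 // => l _.
  have [il|li] := ltnP (ht i) (ht l + k)%N.
    by rewrite [X i l]hA ?[Y i l]hB ?mul0r ?subrr.
  have [lj|jl] := ltnP (ht l) (ht j + k)%N.
    by rewrite [X l j]hA ?[Y l j]hB ?mulr0 ?subrr.
  (* only a diagonal entry at k = 0 is left: products of scalars commute *)
  have -> : l = i by apply: hinj; lia.
  have -> : j = i by apply: hinj; lia.
  by rewrite mulrC subrr.
exists (\max_i ht i).+1; apply/eqP; rewrite -subv0; apply/subvP => A /D h0.
suff E : P *m A *m Q = 0.
  have : Q *m (P *m A *m Q) *m P = 0 by rewrite E mulmx0 mul0mx.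
  by rewrite mulmxA -mulmxA QP mulmx1 mulmxA QP mul1mx memv0 => ->.
apply/matrixP => i j; rewrite h0 ?mxE //.
by rewrite addnS ltnS (leq_trans (leq_bigmax i)) // leq_addl.
Qed.

(** * Matrix coordinates on a Borel subalgebra *)

Section Std.
Variables (K : numFieldType) (r : nat).
Implicit Types x y : 'M[K]_r.

(** One square matrix [x] of size [r] stores an element of the Borel subalgebra
    of a flag: its lower part, diagonal included, is the action on the isotropic
    subspace, and its strict upper part determines a skew matrix. Thus the
    position [(i, j)] carries the root [e_j - e_i] if [j < i], and [e_i + e_j] if
    [i < j]. *)
Definition lower_part x := \matrix_(i, j) (if (j <= i)%N then x i j else 0).
Definition upper_part x := \matrix_(i, j) (if (i < j)%N then x i j else 0).
Definition skew_part x := upper_part x - (upper_part x)^T.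
(** If the rows of [P] are two dual isotropic families, the matrix
    [P^T *m borel_mx x *m P] is skew and has in the basis [P] the matrix
    [polar_mx *m borel_mx x], with blocks [L], [0] above [c], [- L^T], where [L] and
    [c] are the lower and the skew part of [x]. *)
Definition borel_mx x : 'M[K]_(r + r) :=
  block_mx (skew_part x) (- (lower_part x)^T) (lower_part x) 0.
Definition polar_mx : 'M[K]_(r + r) := block_mx 0 1%:M 1%:M 0.

(** The bracket of the Borel subalgebra in the coordinates [x]: see
    [borel_emb_brk]. *)
Definition brk_plus x y : 'M[K]_r :=
  skew_part x *m lower_part y + (lower_part y)^T *m skew_part x
  - skew_part y *m lower_part x - (lower_part x)^T *m skew_part y.
Definition brk x y : 'M[K]_r :=
  lower_part x *m lower_part y - lower_part y *m lower_part x
  + upper_part (brk_plus x y).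

Lemma low_is_linear : linear lower_part.
Proof.
move=> a x y; apply/matrixP=> i j; rewrite !mxE.
by case: ifP => // _; rewrite mulr0 addr0.
Qed.
Lemma upp_is_linear : linear upper_part.
Proof.
move=> a x y; apply/matrixP=> i j; rewrite !mxE.
by case: ifP => // _; rewrite mulr0 addr0.
Qed.
HB.instance Definition _ :=
  GRing.isLinear.Build K _ _ _ lower_part low_is_linear.
HB.instance Definition _ :=
  GRing.isLinear.Build K _ _ _ upper_part upp_is_linear.
Lemma skw_is_linear : linear skew_part.
Proof.
move=> a x y; apply/matrixP=> i j; rewrite !mxE.
by case: (i < j)%N; case: (j < i)%N; ring.
Qed.
HB.instance Definition _ := GRing.isLinear.Build K _ _ _ skew_part skw_is_linear.

Lemma low_upp x : lower_part x + upper_part x = x.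
Proof.
by apply/matrixP=> i j; rewrite !mxE; case: leqP => _; rewrite ?addr0 ?add0r.
Qed.

Lemma low_id x : (forall i j : 'I_r, (i < j)%N -> x i j = 0) -> lower_part x = x.
Proof. by move=> x0; apply/matrixP=> i j; rewrite mxE; case: leqP => // /x0. Qed.

Lemma upp0 x : (forall i j : 'I_r, (i < j)%N -> x i j = 0) -> upper_part x = 0.
Proof. by move=> x0; apply/matrixP=> i j; rewrite !mxE; case: leqP => // /x0. Qed.

Lemma low0 x : (forall i j : 'I_r, (j <= i)%N -> x i j = 0) -> lower_part x = 0.
Proof. by move=> x0; apply/matrixP=> i j; rewrite !mxE; case: leqP => // /x0. Qed.

Lemma lowE x (i j : 'I_r) : (i < j)%N -> lower_part x i j = 0.
Proof. by move=> ij; rewrite mxE leqNgt ij. Qed.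

Lemma low_mulE x y (i j : 'I_r) : (i < j)%N -> (lower_part x *m lower_part y) i j = 0.
Proof.
move=> ij; rewrite mxE big1 // => k _.
have [ik|ki] := ltnP i k; first by rewrite lowE ?mul0r.
by rewrite [lower_part y _ _]lowE ?mulr0 // (leq_ltn_trans ki).
Qed.

Lemma trmxD x y : (x + y)^T = x^T + y^T. Proof. exact: linearD. Qed.
Lemma trmxB x y : (x - y)^T = x^T - y^T. Proof. exact: linearB. Qed.

Lemma tr_skw x : (skew_part x)^T = - skew_part x.
Proof. by rewrite /skew_part linearB /= trmxK opprB. Qed.

Lemma skw_upp x : x^T = - x -> skew_part (upper_part x) = x.
Proof.
move=> xT; apply/matrixP=> i j; have xij : x j i = - x i j.
  by have /matrixP/(_ i j) := xT; rewrite !mxE.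
rewrite !mxE; case: (ltngtP i j) => [_|_|ij]; rewrite ?subr0 ?sub0r ?xij ?opprK //.
have /eqP : x i j = - x i j by rewrite -xij; congr (x _ _); apply: val_inj.
by rewrite -addr_eq0 -mulr2n mulrn_eq0 /= => /eqP.
Qed.

Lemma upp_skw x : upper_part (skew_part x) = upper_part x.
Proof.
by apply/matrixP=> i j; rewrite !mxE; case: ltngtP => //= _; rewrite subr0.
Qed.

Lemma tr_brk_plus x y : (brk_plus x y)^T = - brk_plus x y.
Proof.
rewrite /brk_plus.
move: (skew_part x) (skew_part y) (lower_part x) (lower_part y)
  (tr_skw x) (tr_skw y) => c d l m cT dT.
rewrite !trmxB trmxD !trmx_mul !trmxK cT dT !mulmxN !mulNmx.
move: (c *m m) (m^T *m c) (d *m l) (l^T *m d) => e f g h.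
by apply/matrixP=> i j; rewrite !mxE; ring.
Qed.

Lemma low_brk x y : lower_part (brk x y) =
  lower_part x *m lower_part y - lower_part y *m lower_part x.
Proof.
rewrite linearD /= [X in X + _]low_id => [|i j ij].
  by rewrite [X in _ + X]low0 ?addr0 // => i j ji; rewrite mxE ltnNge ji.
by rewrite [LHS]mxE [X in _ + X]mxE !low_mulE ?subr0.
Qed.

Lemma skw_brk x y : skew_part (brk x y) = brk_plus x y.
Proof.
rewrite -[RHS](skw_upp (tr_brk_plus x y)) linearD /= [X in X + _]/skew_part upp0.
  by rewrite trmx0 subr0 add0r.
by move=> i j ij; rewrite [LHS]mxE [X in _ + X]mxE !low_mulE ?subr0.
Qed.

Lemma polarK : polar_mx *m polar_mx = 1%:M.
Proof.
by rewrite mulmx_block !mul0mx !mulmx0 !mul1mx !add0r !addr0 -scalar_mx_block.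
Qed.

Lemma borel_mx_brk x y :
  borel_mx (brk x y) =
  borel_mx x *m polar_mx *m borel_mx y - borel_mx y *m polar_mx *m borel_mx x.
Proof.
rewrite /borel_mx /polar_mx !mulmx_block.
rewrite !(mul0mx, mulmx0, mul1mx, mulmx1, add0r, addr0).
rewrite opp_block_mx add_block_mx low_brk skw_brk /brk_plus.
move: (skew_part x) (skew_part y) (lower_part x) (lower_part y) => c d l m.
rewrite trmxB !trmx_mul.
rewrite subr0 !(mulmxN, mulNmx) !opprK; congr block_mx.
- move: (c *m m) (m^T *m c) (d *m l) (l^T *m d) => e f g h.
  by apply/matrixP=> i j; rewrite !mxE; ring.
by rewrite opprB.
Qed.

Lemma borel_mx_eq0 x : borel_mx x = 0 -> x = 0.
Proof.
rewrite /borel_mx -[X in _ = X]block_mx0 => /eq_block_mx[s0 _ l0 _].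
by rewrite -(low_upp x) l0 -upp_skw s0 linear0 addr0.
Qed.

Section Phi.
Variable P : 'M[K]_(r + r).
Definition borel_emb x := P^T *m borel_mx x *m P.
Lemma borel_emb_is_linear : linear borel_emb.
Proof.
move=> a x y; rewrite /borel_emb scalemxAl scalemxAr -mulmxDl -mulmxDr.
congr (_ *m _ *m _).
rewrite /borel_mx scale_block_mx add_block_mx !linearP /= scaler0 addr0 scalerN.
by rewrite -opprD.
Qed.
HB.instance Definition _ :=
  GRing.isLinear.Build K _ _ _ borel_emb borel_emb_is_linear.

Lemma borel_emb_orthogonal x : borel_emb x \in orthogonal_lie K (r + r).
Proof.
rewrite memv_orthogonal_lie /borel_emb !trmx_mul trmxK mulmxA; apply/eqP.
rewrite -mulNmx -mulmxN; congr (_ *m _ *m _).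
rewrite /borel_mx tr_block_mx opp_block_mx tr_skw trmx0 oppr0.
by rewrite linearN /= trmxK opprK.
Qed.

Hypothesis PPT : P *m P^T = polar_mx.

Lemma borel_emb_brk x y : lie_bracket (borel_emb x) (borel_emb y) = borel_emb (brk x y).
Proof.
rewrite /lie_bracket /borel_emb borel_mx_brk mulmxBr mulmxBl -PPT.
by rewrite !mulmxA.
Qed.

Lemma borel_emb_inj : injective borel_emb.
Proof.
apply: raddf_inj => x /(congr1 (fun A => P *m A *m P^T)) /=.
rewrite /borel_emb mulmx0 mul0mx !mulmxA PPT -[_ *m _ *m _ *m _]mulmxA PPT => h.
apply: borel_mx_eq0; rewrite -[borel_mx x]mul1mx -[LHS]mulmx1 -polarK.
rewrite mulmxA -[polar_mx *m polar_mx *m _]mulmxA -(mulmxA polar_mx) h.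
by rewrite mulmx0 mul0mx.
Qed.

Lemma borel_emb_img_sub : lie_subalgebra (limg (linfun borel_emb)).
Proof.
apply/lie_subv => _ _ /memv_imgP[x _ ->] /memv_imgP[y _ ->].
by rewrite !lfunE /= borel_emb_brk -[borel_emb _]lfunE memv_img ?memvf.
Qed.

Lemma borel_emb_img_solvable : lie_solvable (limg (linfun borel_emb)).
Proof.
(* the second isotropic half of the basis has to be listed backwards *)
pose ht (i : 'I_(r + r)) : nat :=
  match split i with inl j => j | inr j => ((r + r).-1 - j)%N end.
apply: (@triangular_solvable _ _ P (P^T *m polar_mx) ht) => [|i j|].
- by apply: mulmx1C; rewrite mulmxA PPT polarK.
- rewrite /ht -[i]splitK -[j]splitK !unsplitK.
  case: (split i) (split j) => [i'|i'] [j'|j'] /= ij;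
    have := ltn_ord i'; have := ltn_ord j' => lj li.
  - by congr lshift; apply: val_inj.
  - by exfalso; move: ij lj li; lia.
  - by exfalso; move: ij lj li; lia.
  - by congr rshift; apply: val_inj => /=; move: ij lj li; lia.
move=> _ /memv_imgP[x _ ->] i j; rewrite lfunE /= /borel_emb !mulmxA PPT.
rewrite -(mulmxA _ P) PPT -mulmxA polarK mulmx1 /polar_mx /borel_mx mulmx_block.
rewrite !(mul0mx, mul1mx, addr0, add0r) /ht -{2}[i]splitK -{2}[j]splitK.
have := ltn_ord i; case: (split i) (split j) => [i'|i'] [j'|j'] _ ij;
  rewrite ?block_mxEul ?block_mxEur ?block_mxEdl ?block_mxEdr.
- by rewrite lowE.
- by rewrite mxE.
- by have := ltn_ord i'; have := ltn_ord j'; lia.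
- have ji : (j' < i')%N by have := ltn_ord i'; have := ltn_ord j'; lia.
  by rewrite !mxE leqNgt ji oppr0.
Qed.
End Phi.
End Std.

(** A Borel subalgebra stabilises an isotropic flag [p] of dimension [r], hence
    also the orthogonals of its members; so it is contained in the solvable
    algebra of all matrices with this property, and equals it by maximality. *)
Theorem borel_conjugate (K : numClosedFieldType) r (b : {vspace 'M[K]_(r + r)}) :
  borel_subalgebra (orthogonal_lie K (r + r)) b ->
  exists2 P : 'M[K]_(r + r),
    P *m P^T = polar_mx K r & b = limg (linfun (borel_emb P)).
Proof.
move=> [[bo sb solb] bmax].
have [p [pp pf pb]] := isotropic_flag bo sb solb (leqnn (r + r)).
have [q [qp qq]] := dual_isotropic pp pf.
have pq : p *m q^T = 1%:M by rewrite -[LHS]trmxK trmx_mul trmxK qp trmx1.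
pose P : 'M[K]_(r + r) := col_mx p q.
have PPT : P *m P^T = polar_mx K r by rewrite tr_col_mx mul_col_row pp pq qp qq.
exists P => //; apply/esym/bmax.
  split; [|exact: borel_emb_img_sub|exact: borel_emb_img_solvable].
  by apply/subvP => _ /memv_imgP[x _ ->]; rewrite lfunE; apply: borel_emb_orthogonal.
apply/subvP => A Ab; have [L pA Llow] := pb A Ab.
have AT := orthogonalT bo Ab.
pose c := q *m A *m q^T.
suff -> : A = linfun (borel_emb P) (L + upper_part c) by rewrite memv_img ?memvf.
rewrite lfunE /= /borel_emb.
have QP : P^T *m polar_mx K r *m P = 1%:M.
  by apply: mulmx1C; rewrite mulmxA PPT polarK.
have qA : q *m A *m p^T = - L^T.
  apply: trmx_inj; rewrite !trmx_mul linearN /= !trmxK AT mulNmx mulmxN.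
  by rewrite mulmxA pA -mulmxA pq mulmx1.
have XE : P *m A *m P^T = block_mx 0 L (- L^T) c.
  rewrite tr_col_mx mul_col_mx mul_col_row qA pA -!mulmxA pp pq.
  by rewrite mulmx0 mulmx1 mulmxA.
have -> : borel_mx (L + upper_part c) =
    polar_mx K r *m (P *m A *m P^T) *m polar_mx K r.
  rewrite XE /polar_mx !mulmx_block.
  rewrite !(mul0mx, mulmx0, mul1mx, mulmx1, add0r, addr0).
  rewrite /borel_mx !linearD /= low_id // [lower_part (upper_part c)]low0; last first.
    by move=> i j ji; rewrite mxE ltnNge ji.
  rewrite [skew_part L]/skew_part upp0 // trmx0 subr0 !add0r addr0 skw_upp; last first.
    by rewrite /c !trmx_mul trmxK AT mulNmx mulmxN mulmxA.
  by rewrite subr0.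
have E : P^T *m (polar_mx K r *m (P *m A *m P^T) *m polar_mx K r) *m P =
    P^T *m polar_mx K r *m P *m A *m (P^T *m polar_mx K r *m P) by rewrite !mulmxA.
by rewrite E QP mulmx1 mul1mx.
Qed.

(** * Abelian ideals as sets of positive roots *)

(** The root [e_i + e_j], symmetric in [i] and [j], is stored at the position above
    the diagonal. *)
Definition plus_mem r (S : {set 'I_r * 'I_r}) (i j : 'I_r) : bool :=
  ((i < j)%N && ((i, j) \in S)) || ((j < i)%N && ((j, i) \in S)).

(** Sets of positive roots that span an abelian ideal: [row], [col], [plus] and
    [mixed] express stability under adding a positive root, according to the
    signs involved, [mm] and [mp] that no two members add up to a root. *)
Record abelian_upset r (S : {set 'I_r * 'I_r}) : Prop := AbelianUpset {
  upset_diag : forall i, (i, i) \notin S;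
  upset_row : forall i j k : 'I_r, (j < i)%N -> (i < k)%N ->
    (i, j) \in S -> (k, j) \in S;
  upset_col : forall i j l : 'I_r, (j < i)%N -> (l < j)%N ->
    (i, j) \in S -> (i, l) \in S;
  upset_plus : forall i j l : 'I_r, (l < j)%N -> l != i ->
    plus_mem S i j -> plus_mem S i l;
  upset_mixed : forall k l j : 'I_r, (l < k)%N -> j != k -> j != l ->
    (k, l) \in S -> plus_mem S j l;
  upset_mm : forall i j l : 'I_r, (j < i)%N -> (l < j)%N ->
    (i, j) \in S -> (j, l) \notin S;
  upset_mp : forall k l i : 'I_r, (l < k)%N -> i != l ->
    (k, l) \in S -> ~~ plus_mem S i k }.

Section Ideals.
Variables (K : numFieldType) (r : nat).
Implicit Types (x y z : 'M[K]_r) (S : {set 'I_r * 'I_r}) (V : {vspace 'M[K]_r}).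

Lemma low_lin a x y : lower_part (a *: x + y) = a *: lower_part x + lower_part y.
Proof. exact: linearP. Qed.
Lemma upp_lin a x y : upper_part (a *: x + y) = a *: upper_part x + upper_part y.
Proof. exact: linearP. Qed.
Lemma skw_lin a x y : skew_part (a *: x + y) = a *: skew_part x + skew_part y.
Proof. exact: linearP. Qed.
Lemma tr_lin a x y : (a *: x + y)^T = a *: x^T + y^T.
Proof. exact: linearP. Qed.

Lemma brk_anti x y : brk y x = - brk x y.
Proof.
rewrite /brk opprD opprB; congr (_ + _); rewrite -(linearN (@upper_part K r)) /=.
congr upper_part; rewrite /brk_plus.
move: (skew_part x) (skew_part y) (lower_part x) (lower_part y) => c d l m.
move: (c *m m) (m^T *m c) (d *m l) (l^T *m d) => e f g h.
by apply/matrixP=> i j; rewrite !mxE; ring.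
Qed.

Lemma brk_linl z a x y : brk (a *: x + y) z = a *: brk x z + brk y z.
Proof.
have e : brk_plus (a *: x + y) z = a *: brk_plus x z + brk_plus y z.
  rewrite /brk_plus low_lin skw_lin tr_lin.
  move: (skew_part x) (skew_part y) (skew_part z) => c d e.
  move: (lower_part x) (lower_part y) (lower_part z) => l m n.
  rewrite !(mulmxDl, mulmxDr) -!scalemxAl -!scalemxAr.
  by apply/matrixP=> i j; rewrite ![in LHS]mxE ![in RHS]mxE; ring.
rewrite /brk e upp_lin low_lin scalerDr [RHS]addrACA; congr (_ + _).
move: (lower_part x) (lower_part y) (lower_part z) => l m n.
rewrite !(mulmxDl, mulmxDr) -!scalemxAl -!scalemxAr scalerBr opprD.
by rewrite addrACA.
Qed.

Lemma brk_linr z a x y : brk z (a *: x + y) = a *: brk z x + brk z y.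
Proof. by rewrite brk_anti brk_linl opprD -scalerN -!brk_anti. Qed.

Lemma brk0l x : brk 0 x = 0.
Proof.
have /eqP := brk_linl x 1 0 0; rewrite !scale1r addr0.
by rewrite addrC -subr_eq subrr eq_sym => /eqP.
Qed.
Lemma brk0r x : brk x 0 = 0.
Proof. by rewrite brk_anti brk0l oppr0. Qed.
Lemma brkDl x y z : brk (x + y) z = brk x z + brk y z.
Proof. by rewrite -[x]scale1r brk_linl !scale1r. Qed.
Lemma brkDr x y z : brk z (x + y) = brk z x + brk z y.
Proof. by rewrite -[x]scale1r brk_linr !scale1r. Qed.
Lemma brkZl a x z : brk (a *: x) z = a *: brk x z.
Proof. by rewrite -[a *: x]addr0 brk_linl brk0l addr0. Qed.
Lemma brkZr a x z : brk z (a *: x) = a *: brk z x.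
Proof. by rewrite -[a *: x]addr0 brk_linr brk0r addr0. Qed.

Local Notation E i j := (delta_mx i j : 'M[K]_r).
(** The root vector of [e_i + e_j], up to a sign that makes it alternating in [i]
    and [j]. *)
Definition plus_mx (i j : 'I_r) : 'M[K]_r := upper_part (E i j - E j i).

Lemma low_delta (i j : 'I_r) : lower_part (E i j) = if (j <= i)%N then E i j else 0.
Proof.
case: leqP => ij; [apply: low_id | apply: low0] => k l kl; rewrite mxE;
  case: eqP => // ?; case: eqP => // ?; subst; lia.
Qed.
Lemma upp_delta (i j : 'I_r) : upper_part (E i j) = if (i < j)%N then E i j else 0.
Proof.
rewrite -[upper_part _](addKr (lower_part (E i j))) low_upp low_delta.
by case: ltnP; rewrite ?oppr0 ?add0r ?addNr.
Qed.
Lemma skw_delta (i j : 'I_r) :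
  skew_part (E i j) = if (i < j)%N then E i j - E j i else 0.
Proof.
by rewrite /skew_part upp_delta; case: ltnP; rewrite ?trmx_delta ?trmx0 ?subr0.
Qed.

Lemma plus_mxE (i j : 'I_r) : plus_mx i j =
  if (i < j)%N then E i j else if (j < i)%N then - E j i else 0.
Proof.
rewrite /plus_mx (linearB (@upper_part K r)) /= !upp_delta.
by case: ltngtP => _; rewrite ?subr0 ?sub0r.
Qed.

Lemma brk_deltaNN (i j k l : 'I_r) : (j <= i)%N -> (l <= k)%N ->
  brk (E i j) (E k l) = E i l *+ (j == k) - E k j *+ (l == i).
Proof.
move=> ji lk; rewrite /brk /brk_plus !skw_delta !low_delta ji lk !ltnNge ji lk /=.
rewrite !mul0mx !mulmx0 !subr0 addr0 (linear0 (@upper_part K r)) addr0.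
by rewrite !mul_delta_mx_cond.
Qed.

Lemma brk_deltaPN (i j k l : 'I_r) : (i < j)%N -> (l <= k)%N ->
  brk (E i j) (E k l) = plus_mx i l *+ (j == k) - plus_mx j l *+ (i == k).
Proof.
move=> ij lk; rewrite /brk /brk_plus !skw_delta !low_delta ij lk leqNgt ij ltnNge lk /=.
rewrite trmx0 !mul0mx !mulmx0 !subr0 add0r trmx_delta.
rewrite mulmxBl mulmxBr !mul_delta_mx_cond /plus_mx.
rewrite -!(raddfMn (@upper_part K r)) -raddfB.
congr upper_part; rewrite !mulrnBl ![k == _]eq_sym.
rewrite opprB addrACA [RHS]addrACA.
by congr (_ + _); apply: addrC.
Qed.

Lemma brk_deltaPP (i j k l : 'I_r) : (i < j)%N -> (k < l)%N ->
  brk (E i j) (E k l) = 0.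
Proof.
move=> ij kl; rewrite /brk /brk_plus !low_delta leqNgt ij leqNgt kl /=.
by rewrite trmx0 !mul0mx !mulmx0 !subr0 addr0 add0r (linear0 (@upper_part K r)).
Qed.

Definition root_span S : {vspace 'M[K]_r} := <<[seq E a.1 a.2 | a <- enum S]>>%VS.

Lemma root_span_ind S (T : 'M[K]_r -> Prop) :
    T 0 -> (forall x y, T x -> T y -> T (x + y)) -> (forall a x, T x -> T (a *: x)) ->
    (forall i j, (i, j) \in S -> T (E i j)) ->
  forall x, x \in root_span S -> T x.
Proof.
rewrite /root_span; set s := map _ _ => T0 TD TZ TS x.
move=> /(@coord_span _ _ _ (in_tuple s)) ->.
apply: (big_ind T) => // i _; apply: TZ.
have /mapP[[k l] + ->] := mem_nth 0 (ltn_ord i : (i < size s)%N).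
by rewrite mem_enum; apply: TS.
Qed.

Lemma mem_root_span S x :
  (x \in root_span S) <-> (forall i j, (i, j) \notin S -> x i j = 0).
Proof.
split=> [|x0].
  apply: (@root_span_ind S (fun x => forall i j, (i, j) \notin S -> x i j = 0)) x
    => [i j|y z hy hz i j ij|a y hy i j ij|k l kl i j ij].
  - by rewrite mxE.
  - by rewrite mxE hy ?hz ?addr0.
  - by rewrite mxE hy ?mulr0.
  - rewrite mxE; case: eqP => //= ik; case: eqP => //= jl.
    by rewrite ik jl kl in ij.
rewrite [x]matrix_sum_delta; apply: memv_suml => i _; apply: memv_suml => j _.
have [ijS|/x0 ->] := boolP ((i, j) \in S); last by rewrite scale0r mem0v.
apply: memvZ; apply: memv_span; apply/mapP; exists (i, j) => //.
by rewrite mem_enum.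
Qed.

Lemma delta_root_span S i j : (E i j \in root_span S) = ((i, j) \in S).
Proof.
apply/idP/idP => [/mem_root_span h|ijS].
  by apply: contraT => /h /eqP; rewrite mxE !eqxx /= oner_eq0.
by apply: memv_span; apply/mapP; exists (i, j) => //; rewrite mem_enum.
Qed.

Lemma root_span_inj : injective root_span.
Proof.
by move=> S S' SS'; apply/setP => -[i j]; rewrite -!delta_root_span SS'.
Qed.

(** Both the span of [S] and that of its complement are at most as large as their
    generating families, and together they fill the whole space. *)
Lemma dim_root_span S : \dim (root_span S) = #|S|.
Proof.
have le S' : (\dim (root_span S') <= #|S'|)%N.
  by apply: leq_trans (dim_span _) _; rewrite size_map -cardE.
apply/eqP; rewrite eqn_leq le /=.
have full : (fullv <= root_span S + root_span (~: S))%VS.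
  apply/subvP => x _; rewrite [x]matrix_sum_delta.
  apply: memv_suml => i _; apply: memv_suml => j _; apply: memvZ.
  have [ijS|ijS] := boolP ((i, j) \in S).
    by apply: (subvP (addvSl _ _)); rewrite delta_root_span.
  by apply: (subvP (addvSr _ _)); rewrite delta_root_span inE.
have := dimvS full; rewrite dimvf /dim /= => d1.
have d2 := leq_trans d1 (dimv_add_leqif _ _).1.
have := cardsC S; rewrite card_prod !card_ord => c.
by rewrite -(leq_add2r #|~: S|) c (leq_trans d2) // leq_add2l le.
Qed.

Definition brk_ideal V : Prop :=
  (forall x y, y \in V -> brk x y \in V) /\
  (forall x y, x \in V -> y \in V -> brk x y = 0).

Lemma plus_mx_root_span S i j :
  (i != j -> plus_mem S i j) -> plus_mx i j \in root_span S.
Proof.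
rewrite plus_mxE /plus_mem; case: (ltngtP i j) => [ij h|ij h|_ _].
- by rewrite delta_root_span; move: h; rewrite neq_ltn ij /= orbF; apply.
- by rewrite memvN delta_root_span; move: h; rewrite neq_ltn ij orbT /=; apply.
- exact: mem0v.
Qed.

Lemma abelian_upset_brk_ideal S : abelian_upset S -> brk_ideal (root_span S).
Proof.
move=> vS.
have md (c : bool) x : (c -> x \in root_span S) -> x *+ c \in root_span S.
  by case: c => [->//|_]; rewrite mem0v.
have z (c : bool) x : (c -> x = 0) -> x *+ c = 0.
  by case: c => [->//|_].
have sp (i j : 'I_r) : (i < j)%N -> (i, j) \in S -> plus_mem S i j.
  by move=> ij ijS; rewrite /plus_mem ij ijS.
have spC (i j : 'I_r) : plus_mem S i j = plus_mem S j i by rewrite /plus_mem orbC.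
split=> x y.
  move: y; apply: root_span_ind => [|y y' hy hy'|a y hy|k l klS].
  - by rewrite brk0r mem0v.
  - rewrite brkDr; exact: memvD hy hy'.
  - rewrite brkZr; exact: memvZ hy.
  rewrite [x]matrix_sum_delta.
  pose T w := brk w (E k l) \in root_span S.
  have T0 : T 0 by rewrite /T brk0l mem0v.
  have TD u v : T u -> T v -> T (u + v) by rewrite /T brkDl; apply: memvD.
  apply: (big_ind T T0 TD) => i _; apply: (big_ind T T0 TD) => j _; rewrite /T.
  rewrite brkZl; apply: memvZ.
  have [kl|lk|/val_inj kl] := ltngtP k l; last first.
  - by case/negP: (upset_diag vS l); rewrite -{1}kl.
  - have [ij|ji] := ltnP i j.
      rewrite brk_deltaPN ?(ltnW lk) //; apply: memvB; apply: md => /eqP e; subst.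
        apply: plus_mx_root_span => il; apply: (upset_mixed vS lk) => //.
        by rewrite neq_ltn ij.
      apply: plus_mx_root_span => il; apply: (upset_mixed vS lk) => //.
      by rewrite neq_ltn ij orbT.
    rewrite brk_deltaNN ?(ltnW lk) //; apply: memvB; apply: md => /eqP e; subst.
      rewrite delta_root_span.
      move: ji; rewrite leq_eqVlt => /orP[/eqP/val_inj <-//|ji].
      exact: (upset_row vS lk).
    rewrite delta_root_span.
    move: ji; rewrite leq_eqVlt => /orP[/eqP/val_inj ->//|ji].
    exact: (upset_col vS lk).
  have [ij|ji] := ltnP i j; first by rewrite brk_deltaPP ?mem0v.
  rewrite brk_anti memvN brk_deltaPN //; apply: memvB; apply: md => /eqP e; subst.
    apply: plus_mx_root_span => kj.
    move: ji; rewrite leq_eqVlt => /orP[/eqP/val_inj ->|ji]; first exact: sp.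
    by apply: (upset_plus vS ji); rewrite 1?eq_sym ?sp.
  apply: plus_mx_root_span => kj.
  move: ji; rewrite leq_eqVlt => /orP[/eqP/val_inj ->|ji]; first by rewrite spC sp.
  by apply: (upset_plus vS ji); rewrite 1?eq_sym // spC sp.
move=> xS; move: y; apply: root_span_ind => [|y y' hy hy'|a y hy|k l klS].
- by rewrite brk0r.
- by rewrite brkDr hy hy' addr0.
- by rewrite brkZr hy scaler0.
move: x xS; apply: root_span_ind => [|y y' hy hy'|a y hy|i j ijS].
- by rewrite brk0l.
- by rewrite brkDl hy hy' addr0.
- by rewrite brkZl hy scaler0.
have PN (a b c d : 'I_r) : (a < b)%N -> (d < c)%N -> (a, b) \in S -> (c, d) \in S ->
    brk (E a b) (E c d) = 0.
  move=> ab dc abS cdS; rewrite brk_deltaPN ?(ltnW dc) //.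
  rewrite !z ?subrr // => /eqP e; subst.
    have [->|ad] := eqVneq b d; first by rewrite plus_mxE ltnn.
    by have := upset_mp vS dc ad cdS; rewrite spC sp.
  have [->|ad] := eqVneq a d; first by rewrite plus_mxE ltnn.
  by have := upset_mp vS dc ad cdS; rewrite sp.
have [kl|lk|/val_inj kl] := ltngtP k l; have [ij|ji|/val_inj ij] := ltngtP i j;
  try by [rewrite kl (negPf (upset_diag vS l)) in klS |
          rewrite ij (negPf (upset_diag vS j)) in ijS].
- exact: brk_deltaPP.
- by rewrite brk_anti PN ?oppr0.
- exact: PN.
rewrite brk_deltaNN ?(ltnW lk) ?(ltnW ji) // !z ?subrr // => /eqP e; subst.
  by have := upset_mm vS lk ji klS; rewrite ijS.
by have := upset_mm vS ji lk ijS; rewrite klS.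
Qed.

Lemma delta_mulmxE (i j k l : 'I_r) x : (E i j *m x) k l = x j l *+ (k == i).
Proof.
rewrite mxE (bigD1 j) //= big1 ?addr0 => [|m mj]; rewrite mxE.
  by rewrite eqxx andbT mulr_natl.
by rewrite (negPf mj) andbF mul0r.
Qed.

Lemma mulmx_deltaE (i j k l : 'I_r) x : (x *m E i j) k l = x k i *+ (l == j).
Proof.
rewrite mxE (bigD1 i) //= big1 ?addr0 => [|m mj]; rewrite mxE.
  by rewrite eqxx mulr_natr.
by rewrite (negPf mj) mulr0.
Qed.

(** The value on the [k]-th diagonal matrix of the root at position [(i, j)]. *)
Definition weight (k i j : 'I_r) : K :=
  if (i < j)%N then - ((i == k)%:R + (j == k)%:R) else (i == k)%:R - (j == k)%:R.

Lemma low_lowE x (i j : 'I_r) : (j <= i)%N -> lower_part x i j = x i j.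
Proof. by move=> ji; rewrite mxE ji. Qed.
Lemma skwE x (i j : 'I_r) : (i < j)%N -> skew_part x i j = x i j.
Proof. by move=> ij; rewrite !mxE ij ltnNge ltnW //= subr0. Qed.
Lemma brk_lowE x y (i j : 'I_r) : (j <= i)%N ->
  brk x y i j = (lower_part x *m lower_part y) i j - (lower_part y *m lower_part x) i j.
Proof.
by move=> ji; rewrite -[LHS](low_lowE _ ji) low_brk [LHS]mxE [X in _ + X]mxE.
Qed.
Lemma brk_skwE x y (i j : 'I_r) : (i < j)%N -> brk x y i j = brk_plus x y i j.
Proof. by move=> ij; rewrite -[LHS](skwE _ ij) skw_brk. Qed.

Lemma mxB_entry x y i j : (x - y) i j = x i j - y i j.
Proof. by rewrite !mxE. Qed.

Lemma mxN_entry x i j : (- x) i j = - x i j.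
Proof. by rewrite mxE. Qed.

Lemma brk_cartan k y i j : brk (E k k) y i j = weight k i j * y i j.
Proof.
rewrite /weight; case: ltnP => [ij|ji].
  rewrite brk_skwE // /brk_plus skw_delta ltnn low_delta leqnn mul0mx mulmx0 trmx_delta.
  rewrite addr0 sub0r mxB_entry delta_mulmxE mxN_entry mulmx_deltaE.
  case: eqP => [e|_]; case: eqP => [e'|_];
    rewrite /= ?mulr1n ?mulr0n -?e -?e' ?skwE //; try ring.
    by rewrite e e' ltnn in ij.
  by rewrite e e' ltnn in ij.
rewrite brk_lowE // low_delta leqnn delta_mulmxE mulmx_deltaE.
by case: eqP => [<-|_]; case: eqP => [<-|_];
  rewrite /= ?mulr1n ?mulr0n ?low_lowE //; ring.
Qed.

(** The only roots that are nonzero on both the [p]-th and the [q]-th diagonal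
    matrix are the two at the positions [(p, q)] and [(q, p)], and these are told
    apart by the sign of the product. *)
Lemma weight2 (p q i j : 'I_r) : p != q ->
  let e : K := if (p < q)%N then 1 else -1 in
  weight p i j * weight q i j =
    if (i == p) && (j == q) then e else if (i == q) && (j == p) then - e else 0.
Proof.
move=> pq e; have qp : (q == p) = false by rewrite eq_sym (negPf pq).
rewrite /weight /e; have [->|ip] := eqVneq i p.
  rewrite (negPf pq) /=; have [->|jq] := eqVneq j q.
    rewrite qp; case: ifP => _.
      by rewrite addr0 add0r mulrNN mulr1.
    by rewrite subr0 sub0r mul1r.
  by rewrite !(oppr0, addr0) if_same mulr0.
have [->|iq] := eqVneq i q => /=; last first.
  have [->|jp] := eqVneq j p; first by rewrite (negPf pq) !(oppr0, addr0) if_same mulr0.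
  by rewrite !(oppr0, addr0) if_same mul0r.
have [->|jp] := eqVneq j p; last by rewrite !(oppr0, addr0) if_same mul0r.
rewrite (negPf pq) addr0 add0r subr0 sub0r.
by case: (ltngtP q p) pq => [_|_|/val_inj->]; rewrite ?eqxx // ?mulrNN ?mulr1 ?opprK.
Qed.

Lemma brk_root x (p q : 'I_r) : p != q ->
  brk x (E p q) p q = if (p < q)%N then - (x p p + x q q) else x p p - x q q.
Proof.
move=> pq; have qp : (q == p) = false by rewrite eq_sym (negPf pq).
case: ltnP => [ij|ji].
  rewrite brk_skwE // /brk_plus skw_delta ij low_delta leqNgt ij trmx0 mul0mx mulmx0.
  rewrite addr0 sub0r mulmxBl mulmxBr mxB_entry mxN_entry.
  rewrite !mxB_entry !delta_mulmxE !mulmx_deltaE (negPf pq) qp eqxx /= !subr0 mulr1n.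
  by rewrite eqxx mulr1n [_^T _ _]mxE !low_lowE // opprD addrC.
rewrite brk_lowE // low_delta ji delta_mulmxE mulmx_deltaE !eqxx !mulr1n.
by rewrite !low_lowE.
Qed.

Section FromIdeal.
Variable V : {vspace 'M[K]_r}.
Hypotheses (r2 : (1 < r)%N) (VI : brk_ideal V).

Lemma ideal_weight2 y p q : y \in V ->
  exists2 z, z \in V & forall i j, z i j = weight p i j * weight q i j * y i j.
Proof.
move=> yV; exists (brk (E p p) (brk (E q q) y)).
  exact: (VI.1 _ _ (VI.1 _ _ yV)).
by move=> i j; rewrite 2!brk_cartan mulrA.
Qed.

(** An ideal is stable under diagonal matrices, so it contains the weight
    components of its elements: applying twice the [p]-th and the [q]-th diagonal
    matrix keeps the components at [(p, q)] and [(q, p)] with sign [+], applying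
    each once keeps them with opposite signs. *)
Lemma ideal_delta y p q : y \in V -> p != q -> y p q != 0 -> E p q \in V.
Proof.
move=> yV pq y0.
have [z zV zE] := ideal_weight2 p q yV; have [t tV tE] := ideal_weight2 p q zV.
have s2 : (2 : K) * y p q != 0 by rewrite mulf_neq0 ?pnatr_eq0.
rewrite -[E p q](scalerK s2); apply: memvZ.
pose e : K := if (p < q)%N then 1 else -1.
suff -> : (2 * y p q) *: E p q = t + e *: z by exact: memvD tV (memvZ e zV).
apply/matrixP => i j; rewrite !mxE tE zE (weight2 i j pq) -/e.
have ee : e * e = 1 by rewrite /e; case: ifP => _; rewrite ?mulr1 ?mulrNN ?mulr1.
have [/andP[/eqP-> /eqP->]|_] := boolP ((i == p) && (j == q)).
  by rewrite mulr1 !mulrA ee !mul1r mulrDl mul1r.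
rewrite mulr0; case: ifP => _; last by rewrite !mul0r mulr0 addr0.
by rewrite !mulNr !mulrN opprK !mulrA ee mul1r subrr.
Qed.

(** If the bracket of [y] with a root vector has a nonzero component along that
    root vector, then the ideal contains the root vector, which does not commute
    with [y]. So the diagonal of [y] is annihilated by every root, and the roots at
    [(i, j)] and [(j, i)] involve the sum and the difference of the entries [i]
    and [j]. *)
Lemma ideal_diag y i : y \in V -> y i i = 0.
Proof.
move=> yV.
have key p q : p != q -> brk y (E p q) p q = 0.
  move=> pq; apply/eqP; apply: contraT => h.
  have Ez : brk y (E p q) \in V by rewrite brk_anti memvN VI.1.
  have EV := ideal_delta Ez pq h.
  by rewrite VI.2 // mxE eqxx in h.
have [j ij] : exists j, i != j.
  case: (posnP i) => i0.
    exists (Ordinal r2); apply/eqP => /(congr1 val) /=; lia.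
  exists (Ordinal (ltnW r2)); apply/eqP => /(congr1 val) /=; lia.
have ji : j != i by rewrite eq_sym.
have := key i j ij; rewrite (brk_root y ij).
have := key j i ji; rewrite (brk_root y ji).
case: (ltngtP i j) ij => [_ _|_ _|/val_inj->]; last by rewrite eqxx.
  move=> /eqP; rewrite subr_eq0 => /eqP -> /eqP.
  by rewrite oppr_eq0 -mulr2n mulrn_eq0 => /eqP.
move=> + /eqP; rewrite subr_eq0 => + /eqP e; rewrite -e => /eqP.
by rewrite oppr_eq0 -mulr2n mulrn_eq0 => /eqP.
Qed.

Definition ideal_roots : {set 'I_r * 'I_r} := [set a | E a.1 a.2 \in V].

Lemma mem_ideal_roots i j : ((i, j) \in ideal_roots) = (E i j \in V).
Proof. by rewrite inE. Qed.

Lemma ideal_root_span : V = root_span ideal_roots.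
Proof.
apply/eqP; rewrite eqEsubv; apply/andP; split; apply/subvP => x.
  move=> xV; apply/mem_root_span => i j; rewrite mem_ideal_roots.
  have [->|ij] := eqVneq i j; first by rewrite ideal_diag.
  by move=> h; apply/eqP; apply: contraR h; apply: ideal_delta.
move: x; apply: root_span_ind => [|y z|a y|i j];
  [exact: mem0v|exact: memvD|exact: memvZ|].
by rewrite mem_ideal_roots.
Qed.

Lemma plus_mx_ideal i j : i != j -> (plus_mx i j \in V) = plus_mem ideal_roots i j.
Proof.
rewrite plus_mxE /plus_mem !mem_ideal_roots.
by case: (ltngtP i j) => [_|_|/val_inj->]; rewrite ?orbF ?memvN ?eqxx.
Qed.

Lemma abelian_upset_ideal_roots : abelian_upset ideal_roots.
Proof.
have [I1 I2] := VI.
have EV i j : (i, j) \in ideal_roots -> E i j \in V by rewrite mem_ideal_roots.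
have E0 (i j : 'I_r) : E i j != 0.
  by apply/eqP => /matrixP/(_ i j)/eqP; rewrite !mxE !eqxx oner_eq0.
have p0 (i j : 'I_r) : i != j -> plus_mx i j != 0.
  rewrite plus_mxE; case: (ltngtP i j) => [_|_|/val_inj->]; rewrite ?oppr_eq0 ?eqxx //.
have spl i j : plus_mem ideal_roots i j -> exists p q : 'I_r,
   [/\ (p < q)%N, E p q \in V & ((p, q) = (i, j)) \/ ((p, q) = (j, i))].
  by case/orP => /andP[ij /EV h]; [exists i, j|exists j, i]; split; auto.
split.
- move=> i; rewrite mem_ideal_roots; apply/negP => /(ideal_diag i)/eqP.
  by rewrite mxE eqxx oner_eq0.
- move=> i j k ji ik; rewrite !mem_ideal_roots => /(I1 (E k i)).
  rewrite brk_deltaNN ?(ltnW ik) ?(ltnW ji) // eqxx.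
  case: eqP => [e|_]; first by subst; lia.
  by rewrite subr0.
- move=> i j l ji lj; rewrite !mem_ideal_roots => /(I1 (E j l)).
  rewrite brk_deltaNN ?(ltnW lj) ?(ltnW ji) // eqxx.
  case: eqP => [e|_]; first by subst; lia.
  by rewrite sub0r memvN.
- move=> i j l lj li /spl[p [q [pq h pqE]]]; rewrite -plus_mx_ideal 1?eq_sym //.
  have := I1 (E j l) _ h; rewrite brk_anti memvN brk_deltaPN ?(ltnW lj) //.
  case: pqE pq => [[-> ->]|[-> ->]] pq; rewrite eqxx.
    by case: eqP => [e|_]; [subst; lia|rewrite subr0].
  by case: eqP => [e|_]; [subst; lia|rewrite sub0r memvN].
- move=> k l j lk jk jl /EV h; rewrite -plus_mx_ideal //.
  have [e|kj|e] := ltngtP k j; last by rewrite (val_inj e) eqxx in jk.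
    have := I1 (E k j) _ h; rewrite brk_deltaPN ?(ltnW lk) // eqxx.
    by case: eqP => [e'|_]; [subst; lia|rewrite sub0r memvN].
  have := I1 (E j k) _ h; rewrite brk_deltaPN ?(ltnW lk) // eqxx.
  by case: eqP => [e'|_]; [subst; lia|rewrite subr0].
- move=> i j l ji lj /EV h; rewrite mem_ideal_roots; apply/negP => /(I2 _ _ h).
  rewrite brk_deltaNN ?(ltnW lj) ?(ltnW ji) // eqxx.
  case: eqP => [e|_]; first by subst; lia.
  by rewrite subr0 => /eqP; rewrite (negPf (E0 _ _)).
move=> k l i lk il /EV h; apply/negP => /spl[p [q [pq h' pqE]]].
have := I2 _ _ h' h; rewrite brk_deltaPN ?(ltnW lk) //.
case: pqE pq => [[-> ->]|[-> ->]] pq; rewrite eqxx.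
  by case: eqP => [e|_]; [subst; lia|rewrite subr0 => /eqP; rewrite (negPf (p0 _ _ _))].
case: eqP => [e|_]; first by subst; lia.
by rewrite sub0r => /eqP; rewrite oppr_eq0 (negPf (p0 _ _ _)).
Qed.
End FromIdeal.
End Ideals.

(** * Generating functions of families of finite sets *)

Section GF.
Variable T : finType.
Implicit Types (V W Q : {set T} -> Prop) (S D : {set T}).

Definition card_gf V : {poly nat} := \sum_(S : {set T} | `[< V S >]) 'X^#|S|.

Lemma card_gf_ext V W : (forall S, V S <-> W S) -> card_gf V = card_gf W.
Proof. by move=> VW; apply: eq_bigl => S; apply: asbool_equiv_eq. Qed.

Lemma card_gf_split Q V :
  card_gf V = card_gf (fun S => V S /\ Q S) + card_gf (fun S => V S /\ ~ Q S).
Proof.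
rewrite /card_gf (bigID (fun S => `[< Q S >])) /=; congr (_ + _); apply: eq_bigl => S.
  by rewrite asbool_and.
by rewrite asbool_and asbool_neg.
Qed.

Lemma card_gf_empty V : (forall S, ~ V S) -> card_gf V = 0.
Proof. by move=> V0; apply: big_pred0 => S; apply/asboolP/V0. Qed.

Lemma coef_card_gf V m : (card_gf V)`_m = #|[set S | `[< V S >] & #|S| == m]|.
Proof.
rewrite coef_sum -[RHS]sum1dep_card [RHS]big_mkcondr /=; apply: eq_bigr => S _.
by rewrite coefXn eq_sym; case: (_ == _).
Qed.

(** Adding the fixed set [D] is a bijection from [W] to [V]. *)
Lemma card_gf_shift D V W :
    (forall S, V S -> D \subset S /\ W (S :\: D)) ->
    (forall S, W S -> [disjoint D & S] /\ V (D :|: S)) ->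
  card_gf V = 'X^#|D| * card_gf W.
Proof.
move=> VW WV.
have DS S : [disjoint D & S] -> (D :|: S) :\: D = S.
  by move=> dDS; rewrite setDUl setDv set0U; apply/setDidPl; rewrite disjoint_sym.
rewrite /card_gf (reindex_onto (fun S => D :|: S) (fun S => S :\: D)) /=; last first.
  by move=> S /asboolP/VW[DS' _]; rewrite setDE setUIr setUCr setIT; apply/setUidPr.
rewrite big_distrr /=; apply: eq_big => [S|S /andP[_ /eqP eS]].
  apply/andP/asboolP => [[/asboolP/VW[_ +] /eqP e]|/WV[dDS VDS]]; first by rewrite e.
  by split; [apply/asboolP|rewrite DS].
rewrite -exprD cardsU -[in X in D :&: X]eS.
by rewrite setIDA setDIl setDv set0I cards0 subn0.
Qed.

Lemma card_gf_involution (f : T -> T) V : involutive f ->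
  card_gf (fun S => V (f @^-1: S)) = card_gf V.
Proof.
move=> ff; have fK : involutive (fun S : {set T} => f @^-1: S).
  by move=> S; apply/setP => x; rewrite !inE ff.
rewrite /card_gf [RHS](reindex_inj (inv_inj fK)); apply: eq_bigr => S _.
by rewrite (card_preimset _ (inv_inj ff)).
Qed.
End GF.

Section Stair.
Variable r : nat.
Implicit Types S : {set 'I_r * 'I_r}.

(** The upper sets of the roots [e_i + e_j] with [a <= i < j < b]. Row [i] of such a
    set is an initial interval, and the lengths of the nonempty rows decrease
    strictly. *)
Definition stair (a b : nat) S : Prop :=
  (forall i j, (i, j) \in S -> [/\ (a <= i)%N, (i < j)%N & (j < b)%N]) /\
  (forall i j i' j' : 'I_r, (i, j) \in S ->
    (a <= i')%N -> (i' < j')%N -> (i' <= i)%N -> (j' <= j)%N -> (i', j') \in S).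

Lemma card_interval a b : (b <= r)%N -> #|[set j : 'I_r | (a <= j < b)%N]| = (b - a)%N.
Proof.
move=> br; rewrite -sum1dep_card -(big_mkord (fun j => a <= j < b)%N (fun=> 1%N)).
rewrite -[RHS]muln1 -sum_nat_const_nat [RHS](big_nat_widenl _ 0) //.
by rewrite [RHS](big_nat_widen _ _ r).
Qed.

Lemma card_row_interval (i : 'I_r) a b : (b <= r)%N ->
  #|[set x : 'I_r * 'I_r | (x.1 == i) && (a <= x.2 < b)%N]| = (b - a)%N.
Proof.
move=> br; rewrite -(card_interval a br) -[RHS]mul1n -(cards1 i) -cardsX.
by congr #|pred_of_set _|; apply/setP => -[k l]; rewrite !inE.
Qed.

Lemma card_col_interval (j : 'I_r) a b : (b <= r)%N ->
  #|[set x : 'I_r * 'I_r | (x.2 == j) && (a <= x.1 < b)%N]| = (b - a)%N.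
Proof.
move=> br; rewrite -(card_interval a br) -[RHS]muln1 -(cards1 j) -cardsX.
by congr #|pred_of_set _|; apply/setP => -[k l]; rewrite !inE andbC.
Qed.

(** If the smallest root [e_i0 + e_j0] of the first row belongs to the set, so
    does the whole row, and the other rows are unconstrained by it. *)
Lemma card_gf_stair_full (i0 j0 : 'I_r) : (i0 < j0)%N ->
  card_gf (fun S => stair i0 j0.+1 S /\ (i0, j0) \in S) =
  'X^(j0 - i0) * card_gf (stair i0.+1 j0.+1).
Proof.
move=> ij0; rewrite -[(j0 - i0)%N]subSS -(card_row_interval i0 i0.+1 (ltn_ord j0)).
apply: card_gf_shift => [S [[Sr Sc] ijS]|S [Sr Sc]].
  split; first apply/subsetP => -[i j].
    by rewrite inE => /= /andP[/eqP-> /andP[ij jj]]; apply: Sc ijS _ _ _ _; lia.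
  split=> [i j|i j i' j']; rewrite !inE /=.
    case/andP => h /Sr[ii ij jj]; split=> //.
    rewrite ltn_neqAle ii andbT; apply: contra h => /eqP/val_inj->.
    by rewrite eqxx; lia.
  case/andP => _ ijS' i0i' i'j' i'i j'j.
  have -> : (i' == i0) = false by apply/eqP => e; subst; lia.
  by apply: Sc ijS' _ _ _ _ => //; lia.
split.
  rewrite disjoint_subset; apply/subsetP => -[i j]; rewrite !inE /= => /andP[/eqP-> _].
  by apply/negP => /Sr[]; lia.
split; last by rewrite !inE /= eqxx ij0 ltnSn.
split=> [i j|i j i' j']; rewrite !inE /=.
  by case/orP => [/andP[/eqP-> h]|/Sr[h1 h2 h3]]; split; lia.
move=> ijS i0i' i'j' i'i j'j.
have [e|ne] := eqVneq i' i0.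
  subst; case/orP: ijS => [/andP[/eqP ? ?]|/Sr[? ? ?]]; subst; lia.
have lt : (i0 < i')%N by rewrite ltn_neqAle eq_sym ne.
case/orP: ijS => [/andP[/eqP e ?]|h]; first by subst; lia.
by rewrite (Sc _ _ _ _ h).
Qed.

Lemma card_gf_stair0 a b : (b <= a.+1)%N -> card_gf (stair a b) = 1.
Proof.
move=> ba; rewrite /card_gf (big_pred1 set0) ?cards0 ?expr0 // => S.
apply/asboolP/eqP => [[Sr _]|->]; last by split=> i j; rewrite inE.
by apply/setP => -[i j]; rewrite inE; apply/negP => /Sr[]; lia.
Qed.

(** Strict partitions with parts less than [n], counted by deciding whether the
    largest part occurs. *)
Lemma card_gf_stair n a : (a + n <= r)%N ->
  card_gf (stair a (a + n)) = \prod_(1 <= j < n) (1 + 'X^j).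
Proof.
elim: n a => [|[|n] IH] a an.
- by rewrite card_gf_stair0 ?big_geq //; lia.
- by rewrite card_gf_stair0 ?big_geq //; lia.
have ar : (a < r)%N by lia.
have br : (a + n.+1 < r)%N by lia.
pose i0 := Ordinal ar; pose j0 := Ordinal br.
rewrite big_nat_recr //= mulrDr mulr1 (card_gf_split (fun S => (i0, j0) \in S)) addrC.
congr (_ + _).
  rewrite -(IH a); last lia.
  apply: card_gf_ext => S; split=> [[[Sr Sc] ijS]|[Sr Sc]]; split.
  - move=> i j ijS'; have [ai ij jb] := Sr _ _ ijS'; split=> //.
    rewrite ltn_neqAle -ltnS -addnS jb andbT; apply/eqP => e; apply: ijS.
    by apply: Sc ijS' _ _ _ _ => //=; lia.
  - by move=> i j i' j' ijS'; apply: Sc ijS'.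
  - by split=> // i j /Sr[? ? ?]; split=> //; lia.
  - by move=> /Sr[_ _] /=; rewrite ltnn.
have := @card_gf_stair_full i0 j0; rewrite /= -!addnS addKn => ->; last lia.
by rewrite mulrC -(IH a.+1) ?addSnnS.
Qed.

Lemma plus_memC S (i j : 'I_r) : plus_mem S i j = plus_mem S j i.
Proof. by rewrite /plus_mem orbC. Qed.

Lemma plus_mem_lt S (i j : 'I_r) : (i < j)%N -> plus_mem S i j = ((i, j) \in S).
Proof. by move=> ij; rewrite /plus_mem ij ltnNge (ltnW ij) orbF. Qed.

(** The indices [i] and [j] are lowered one after the other; if [j'] equals [i],
    the other index has to go first, to avoid the non-root [2 e_i]. *)
Lemma plus_closed S (i j i' j' : 'I_r) :
  abelian_upset S -> (i < j)%N -> (i, j) \in S ->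
  (i' < j')%N -> (i' <= i)%N -> (j' <= j)%N -> (i', j') \in S.
Proof.
move=> vS ij ijS ij' ii' jj'; rewrite -plus_mem_lt //; rewrite -plus_mem_lt // in ijS.
have mv (u v w : 'I_r) : plus_mem S u v -> (w <= v)%N -> w != u -> plus_mem S u w.
  rewrite leq_eqVlt => h /orP[/eqP/val_inj->//|wv] wu.
  exact: (upset_plus vS wv).
have [e|ne] := eqVneq j' i.
  have i'j : i' != j by rewrite -val_eqE /= ltn_eqF // (leq_trans ij').
  have j'i' : j' != i' by rewrite -val_eqE /= gtn_eqF.
  rewrite -e plus_memC in ijS; have := mv _ _ _ ijS (ltnW ij') i'j.
  by rewrite plus_memC => h; apply: (mv i' j).
have h := mv _ _ _ ijS jj' ne; rewrite plus_memC in h.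
by rewrite plus_memC; apply: (mv j' i) => //; rewrite neq_ltn ij'.
Qed.

End Stair.

(** * Counting the abelian upper sets of positive roots *)

Section Count.
Variable n : nat.
Local Notation r := n.+2.
Implicit Types (S : {set 'I_r * 'I_r}) (i j k l : 'I_r).
Local Notation o := (ord0 : 'I_r).
Local Notation m := (ord_max : 'I_r).

(** Any root [e_j - e_i] in an upper set forces [e_0 - e_m], where [m = r - 1], so
    this case consists of sums [e_i + e_j] only, and these commute. *)
Lemma abelian_upset_stair S :
  (abelian_upset S /\ (m, o) \notin S) <-> stair 0 r S.
Proof.
split=> [[vS moS]|[Sr Sc]].
  have lt i j : (i, j) \in S -> (i < j)%N.
    move=> ijS; rewrite ltnNge; apply/negP; rewrite leq_eqVlt.
    case/orP => [/eqP/val_inj e|ji].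
      by have := upset_diag vS i; rewrite -{2}e ijS.
    have miS : (m, j) \in S.
      have := leq_ord i; rewrite leq_eqVlt => /orP[/eqP e|im].
        by rewrite (_ : m = i) //; apply: val_inj.
      exact: (upset_row vS ji).
    case/negP: moS; case: (posnP j) => [j0|j0].
      by rewrite (_ : o = j) //; apply: val_inj.
    by apply: (upset_col vS _ _ miS) => //=; have := ltn_ord i; lia.
  split=> [i j /lt ij|i j i' j' ijS _ ij' ii' jj']; first by split.
  exact: plus_closed vS (lt _ _ ijS) ijS ij' ii' jj'.
have nS i j : (j <= i)%N -> (i, j) \in S = false.
  by move=> ji; apply/negP => /Sr[]; lia.
split; last by rewrite nS.
split=> [i|i j k ji|i j l ji|i j l lj li|k l j lk|i j l ji|k l i lk].
- by rewrite nS.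
- by rewrite nS // ltnW.
- by rewrite nS // ltnW.
- case/orP=> /andP[ij ijS];
    case: (ltngtP l i) li => [li _|il _|/val_inj->]; rewrite ?eqxx //.
  + by rewrite plus_memC plus_mem_lt //; apply: Sc ijS _ _ _ _ => //; lia.
  + by rewrite plus_mem_lt //; apply: Sc ijS _ _ _ _ => //; lia.
  + by rewrite plus_memC plus_mem_lt //; apply: Sc ijS _ _ _ _ => //; lia.
  + lia.
- by rewrite (nS k l) // ltnW.
- by rewrite nS // ltnW.
- by rewrite (nS k l) // ltnW.
Qed.

(** The roots [e_0 - e_i] with [q < i], and all [e_0 + e_j]. *)
Definition hook (q : nat) : {set 'I_r * 'I_r} :=
  [set x : 'I_r * 'I_r | (x.2 == o) && (q < x.1 < r)%N] :|:
  [set x : 'I_r * 'I_r | (x.1 == o) && (0 < x.2 < r)%N].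

Lemma mem_hook q i j : ((i, j) \in hook q) =
  ((j == 0 :> nat) && (q < i)%N) || ((i == 0 :> nat) && (0 < j)%N).
Proof. by rewrite !inE /= !ltn_ord !andbT. Qed.

Lemma card_hook q : (q < r)%N -> #|hook q| = (r - q.+1 + r.-1)%N.
Proof.
move=> qr; rewrite cardsU card_row_interval // card_col_interval //.
rewrite (_ : _ :&: _ = set0) ?cards0 ?subn0 ?subn1 //.
by apply/setP => -[i j]; rewrite !inE /=; case: eqP => //= ->; rewrite /= !andbF.
Qed.

(** Here [e_0 - e_(q+1)] is the lowest root of the form [e_0 - e_i] in [S]. It and
    [e_0 + e_m] force the hook. No root outside the hook can involve an index
    beyond [q], nor be a difference [e_i - e_j] with [0 < i], since it would add
    up to a root with a member of the hook. *)
Lemma hook_range (q q1 : 'I_r) S : q1 = q.+1 :> nat ->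
  abelian_upset S -> (q1, o) \in S -> (o, m) \in S -> (q, o) \notin S ->
  hook q \subset S /\ stair 1 q.+1 (S :\: hook q).
Proof.
move=> q1q vS q1S omS qS.
have oE i : (i : nat) = 0%N -> i = o by move=> i0; apply: val_inj.
have row i : (q < i)%N -> (i, o) \in S.
  rewrite -q1q leq_eqVlt => /orP[/eqP/val_inj<-//|qi].
  by apply: (upset_row vS _ qi q1S); rewrite /= q1q.
have col j : (0 < j)%N -> (o, j) \in S.
  by move=> j0; apply: (plus_closed vS _ omS) => //; apply: leq_ord.
have nrow i : (i, o) \in S -> (q < i)%N.
  move=> iS; rewrite ltnNge; apply/negP; rewrite leq_eqVlt => /orP[/eqP/val_inj e|iq].
    by rewrite -e iS in qS.
  case: (posnP i) => [/oE i0|i0]; first by have := upset_diag vS o; rewrite -{1}i0 iS.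
  by case/negP: qS; apply: (upset_row vS _ iq iS).
have rng i j : (i, j) \notin hook q -> (i, j) \in S -> [/\ 0 < i, i < j & j < q.+1]%N.
  rewrite mem_hook => + ijS.
  case: (ltngtP i j) => [ij|ji|/val_inj e].
  - case: (posnP i) => i0 h; first by lia.
    split=> //; rewrite ltnS leqNgt; apply/negP => /row jS.
    have io : i != o by rewrite -val_eqE /= -lt0n.
    have oj : (o < j)%N by apply: leq_ltn_trans ij.
    have := upset_mp vS oj io jS.
    by rewrite plus_mem_lt // ijS.
  - case: (posnP j) => j0.
      by have := ijS; rewrite (oE j j0) => /nrow ->.
    have oj : o != j by rewrite -val_eqE /= eq_sym -lt0n.
    by have := upset_mp vS ji oj ijS; rewrite plus_mem_lt ?col //=; lia.
  - by have := upset_diag vS i; rewrite {2}e ijS.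
split.
  apply/subsetP => -[i j]; rewrite mem_hook.
  case/orP=> /andP[/eqP e h]; first by rewrite (oE j e) row.
  by rewrite (oE i e) col.
split=> [i j|i j i' j']; rewrite !in_setD => /andP[h ijS]; first exact: rng.
have [i0 ij jq] := rng _ _ h ijS => i'0 ij' ii' jj'.
by rewrite mem_hook (plus_closed vS ij ijS) // andbT; lia.
Qed.

Lemma hook_abelian_upset (q q1 : 'I_r) S : q1 = q.+1 :> nat -> stair 1 q.+1 S ->
  [disjoint hook q & S] /\
  [/\ abelian_upset (hook q :|: S), (q1, o) \in hook q :|: S,
      (o, m) \in hook q :|: S & (q, o) \notin hook q :|: S].
Proof.
move=> q1q [Sr Sc]; set U := _ :|: S.
have memU i j : ((i, j) \in U) =
    [|| (j == 0 :> nat) && (q < i)%N, (i == 0 :> nat) && (0 < j)%N | (i, j) \in S].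
  by rewrite inE mem_hook orbA.
have spS i j : plus_mem S i j -> [/\ 0 < i <= q, 0 < j <= q & i != j :> nat]%N.
  by case/orP => /andP[_ /Sr[? ? ?]]; split; lia.
have spSc i j l : plus_mem S i j -> (l < j)%N -> l != i -> (0 < l)%N -> plus_mem S i l.
  have := ltn_ord i => _ + lj; rewrite -val_eqE /= neq_ltn.
  case/orP=> /andP[ij ijS] /orP[li|il] l0.
  - by rewrite plus_memC plus_mem_lt // (Sc _ _ _ _ ijS) // ltnW.
  - by rewrite plus_mem_lt // (Sc _ _ _ _ ijS) //; have [] := Sr _ _ ijS; lia.
  - by rewrite plus_memC plus_mem_lt // (Sc _ _ _ _ ijS) // ltnW.
  - lia.
have spU i j : plus_mem U i j =
    (i != j :> nat) && [|| i == 0 :> nat, j == 0 :> nat | plus_mem S i j].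
  have := Sr i j; have := Sr j i; rewrite /plus_mem !memU.
  case: ((i, j) \in S); case: ((j, i) \in S) => h1 h2;
    try (case: (h1 isT) => ? ? ?); try (case: (h2 isT) => ? ? ?); lia.
split.
  rewrite -setI_eq0; apply/eqP/setP => -[i j]; rewrite in_setI mem_hook in_set0.
  by apply/negP => /andP[h /Sr[? ? ?]]; lia.
split; [split|rewrite memU /=; lia|rewrite memU /=; lia|].
- by move=> i; rewrite memU; apply/negP => /or3P[|| /Sr[]]; lia.
- by move=> i j k ji ik; rewrite !memU => /or3P[||/Sr[]]; lia.
- by move=> i j k ji ik; rewrite !memU => /or3P[||/Sr[]]; lia.
- move=> i j l lj li; rewrite !spU => /andP[ij h].
  have li' : l != i :> nat by [].
  have [l0|l0] := posnP l; first by rewrite l0; lia.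
  case/or3P: h => [h|h|h]; [lia|lia|].
  by rewrite (spSc _ _ _ h lj li l0); lia.
- move=> k l j lk jk jl; rewrite memU spU => h.
  have jl' : j != l :> nat by [].
  by case/or3P: h => [||/Sr[]]; lia.
- by move=> i j l ji lj; rewrite !memU => /or3P[||/Sr[]]; lia.
- move=> k l i lk il; rewrite memU spU => h; have il' : i != l :> nat by [].
  apply/negP => /andP[ik /or3P[||/spS[]]]; by case/or3P: h => [||/Sr[]]; lia.
by rewrite memU; apply/negP => /or3P[||/Sr[]] /=; lia.
Qed.

Lemma card_gf_hook (q q1 : 'I_r) : q1 = q.+1 :> nat ->
  card_gf (fun S =>
    [/\ abelian_upset S, (q1, o) \in S, (o, m) \in S & (q, o) \notin S]) =
  'X^(r - q.+1 + r.-1) * card_gf (@stair r 1 q.+1).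
Proof.
move=> q1q; rewrite -card_hook ?ltn_ord //.
apply: card_gf_shift => S; first by case=> vS q1S omS qS; apply: (hook_range q1q).
exact: hook_abelian_upset.
Qed.

Lemma card_gf_hooks (q : 'I_r) :
  card_gf (fun S => [/\ abelian_upset S, (q, o) \in S & (o, m) \in S]) =
  \sum_(0 <= p < q) 'X^(r - p.+1 + r.-1) * card_gf (@stair r 1 p.+1).
Proof.
case: q => q; elim: q => [|q IH] qr /=.
  rewrite big_geq //; apply: card_gf_empty => S [vS + _].
  by rewrite (_ : Ordinal qr = o) ?(negPf (upset_diag vS o)) //; apply: val_inj.
have qr' : (q < r)%N by apply: ltnW.
rewrite big_nat_recr //= -(IH qr') -(@card_gf_hook (Ordinal qr') (Ordinal qr)) //.
rewrite (card_gf_split (fun S => (Ordinal qr', o) \in S)); congr (_ + _).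
  apply: card_gf_ext => S; split=> [[[vS q1S omS] qS]|[vS qS omS]] //.
  split=> //; split=> //; apply: (upset_row vS _ _ qS) => //=.
  case: (posnP q) => // q0; have := upset_diag vS o.
  by rewrite -{1}(_ : Ordinal qr' = o) ?qS //; apply: val_inj.
by apply: card_gf_ext => S; split=> [[[vS q1S omS] /negP qS]|[vS q1S omS /negP qS]].
Qed.

(** The diagram automorphism, which changes the sign of [e_m]. *)
Definition swap (x : 'I_r * 'I_r) :=
  if (x.1 == m) || (x.2 == m) then (x.2, x.1) else x.

Lemma swapK : involutive swap.
Proof.
case=> i j; rewrite /swap /=.
by case h: ((i == m) || (j == m)); rewrite /= ?h // orbC h.
Qed.

(** If [e_0 - e_m] belongs to [S] and [e_0 + e_m] does not, then no root in [S]
    has [e_m] with sign [+] or is a difference of two smaller indices, and the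
    diagram automorphism turns [S] into a set of sums. *)
Lemma swap_abelian_upset S :
  [/\ abelian_upset S, (m, o) \in S & (o, m) \notin S] <->
  stair o m.+1 (swap @^-1: S) /\ (o, m) \in swap @^-1: S.
Proof.
have oE i : (i : nat) = 0%N -> i = o by move=> i0; apply: val_inj.
have mE i : (n < i)%N -> i = m.
  by move=> im; apply: val_inj => /=; have := ltn_ord i; lia.
have leE i : (i <= n.+1)%N by exact: leq_ord.
have swE i j : ((i, j) \in swap @^-1: S) =
    if (n < i)%N || (n < j)%N then (j, i) \in S else (i, j) \in S.
  have e k : (k == m) = (n < k)%N by rewrite -val_eqE /= eqn_leq leE.
  by rewrite inE /swap /= !e; case: ifP.
split=> [[vS moS omS]|[[Sr Sc] omS]].
  have nrow i : (i <= n)%N -> (i, o) \notin S.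
    move=> im; apply/negP => iS; case: (posnP i) => [/oE i0|i0].
      by have := upset_diag vS o; rewrite -{1}i0 iS.
    have mi : m != i by rewrite -val_eqE /=; lia.
    have oi : (o < i)%N by [].
    have mo : m != o by [].
    by have := upset_mixed vS oi mi mo iS; rewrite plus_memC plus_mem_lt // (negPf omS).
  have ncol i : (i <= n)%N -> (i, m) \notin S.
    move=> im; apply/negP => iS; case: (posnP i) => [/oE i0|i0].
      by rewrite -i0 iS in omS.
    have oi : (o < i)%N by [].
    have om : o != m by [].
    have mi : plus_mem S m i by rewrite plus_memC plus_mem_lt.
    by have := upset_plus vS oi om mi; rewrite plus_memC plus_mem_lt // (negPf omS).
  have lt i j : (i <= n)%N -> (i, j) \in S -> (i < j)%N.
    move=> im ijS; rewrite ltnNge; apply/negP; rewrite leq_eqVlt.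
    case/orP => [/eqP/val_inj e|ji].
      by have := upset_diag vS i; rewrite -{2}e ijS.
    case/negP: (nrow i im); case: (posnP j) => [/oE j0|j0]; first by rewrite -j0.
    by apply: (upset_col vS ji _ ijS).
  have ltm j : (m, j) \in S -> (j <= n)%N.
    move=> mj; rewrite leqNgt; apply/negP => /mE e.
    by have := upset_diag vS m; rewrite -{2}e mj.
  have rng i j : (i, j) \in swap @^-1: S -> (i < j)%N.
    rewrite swE; case: ifP => [/orP[/mE ->|/mE ->]|/negbT]; last 1 first.
    - by rewrite negb_or -!leqNgt => /andP[im _]; apply: lt.
    - move=> h; have := leE j; rewrite leq_eqVlt => /orP[/eqP e|jn].
        have e' : j = m by apply: val_inj.
        by have := upset_diag vS m; rewrite -{1}e' h.
      by rewrite (negPf (ncol _ _)) in h.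
    - by move=> /ltm.
  split; last by rewrite swE /= ltnSn.
  split=> [i j /rng ij|i j i' j' ijS _ ij' ii' jj']; first by split.
  have ij := rng _ _ ijS; move: ijS; rewrite !swE.
  have -> : (n < i)%N = false by have := leE j; lia.
  have -> : (n < i')%N = false by have := leE j'; lia.
  rewrite /=; case: (ltnP n j) => jn; case: (ltnP n j') => jn'; last 1 first.
  - by move=> ijS; apply: (plus_closed vS ij ijS).
  - rewrite (mE j) // (mE j') // => h; move: ii'; rewrite leq_eqVlt.
    case/orP => [/eqP/val_inj->//|ii'].
    by apply: (upset_col vS _ ii' h); have := leE j; rewrite /=; lia.
  - rewrite (mE j) // => h.
    have h' : (m, i') \in S.
      move: ii'; rewrite leq_eqVlt => /orP[/eqP/val_inj->//|ii'].
      by apply: (upset_col vS _ ii' h); have := leE j; rewrite /=; lia.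
    have := @upset_mixed _ _ vS m i' j' _ _ _ h'.
    rewrite plus_memC plus_mem_lt //; apply.
    + by rewrite /=; lia.
    + by rewrite -val_eqE /=; lia.
    + by rewrite -val_eqE /=; lia.
  - lia.
set P := swap @^-1: S in Sr Sc omS *.
have SE i j : ((i, j) \in S) =
    if (n < i)%N || (n < j)%N then (j, i) \in P else (i, j) \in P.
  by rewrite !swE orbC; case: ifP => h; rewrite h.
have sp i j : plus_mem S i j ->
    [/\ (i <= n)%N, (j <= n)%N &
      ((i < j)%N /\ (i, j) \in P) \/ ((j < i)%N /\ (j, i) \in P)].
  have h (a b : 'I_r) : (a < b)%N -> (a, b) \in S ->
      [/\ (a <= n)%N, (b <= n)%N & (a, b) \in P].
    move=> ab; rewrite SE; case: ifP => [_ /Sr[]|/negbT]; first by lia.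
    by rewrite negb_or -!leqNgt => /andP[].
  by case/orP=> /andP[ij /(h _ _ ij)[? ? ?]]; split=> //; [left|right].
have spI i j : (i < j)%N -> (j <= n)%N -> (i, j) \in P -> plus_mem S i j.
  move=> ij jn ijP; rewrite plus_mem_lt // SE !ltnNge jn.
  by rewrite (leq_trans (ltnW ij) jn).
have neg i j : (j < i)%N -> (i, j) \in S -> (n < i)%N /\ (j, i) \in P.
  by move=> ji; rewrite SE; case: ifP => [h ijP|_ /Sr[]]; [split=> //; lia|lia].
have negI i j : (n < i)%N -> (j, i) \in P -> (i, j) \in S.
  by move=> ni ijP; rewrite SE ni.
split; last first.
- by rewrite SE /= ltnSn; apply/negP => /Sr[].
- exact: negI.
split.
- by move=> i; rewrite SE if_same; apply/negP => /Sr[]; lia.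
- by move=> i j k ji ik /(neg _ _ ji)[]; have := leE k; lia.
- move=> i j l ji lj /(neg _ _ ji)[ni jiP]; apply: negI => //.
  by apply: Sc jiP _ _ _ _ => //; lia.
- move=> i j l lj li /sp[im jm h].
  have {}li : l != i :> nat by [].
  case: (ltngtP l i) li => // [li _|il _]; case: h => [[ij ijP]|[ji ijP]].
  + by rewrite plus_memC; apply: spI => //; apply: Sc ijP _ _ _ _ => //; lia.
  + by rewrite plus_memC; apply: spI => //; apply: Sc ijP _ _ _ _ => //; lia.
  + by apply: spI; [|lia|apply: Sc ijP _ _ _ _ => //; lia].
  + lia.
- move=> k l j lk jk jl /(neg _ _ lk)[nk lkP].
  have jn : (j <= n)%N.
    by rewrite leqNgt; apply/negP => /mE e; move: jk; rewrite e (mE k nk) eqxx.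
  have {}jl : j != l :> nat by [].
  case: (ltngtP j l) jl => // [jl _|lj _].
    by apply: spI => //; [have := leE k; lia|apply: Sc lkP _ _ _ _ => //; lia].
  by rewrite plus_memC; apply: spI => //; apply: Sc lkP _ _ _ _ => //; lia.
- move=> i j l ji lj /(neg _ _ ji)[ni _]; apply/negP => /(neg _ _ lj)[nj _].
  by have := leE i; lia.
- move=> k l i lk il /(neg _ _ lk)[nk _]; apply/negP => /sp[_]; lia.
Qed.

(** The case without [e_0 - e_m] yields the last product of [f_D]; the case with
    both [e_0 - e_m] and [e_0 + e_m] yields the power [2r - 2] and the summands
    [k < r - 2]; the case with [e_0 - e_m] alone yields the summand [k = r - 2]. *)
Theorem card_gf_abelian_upset : card_gf (@abelian_upset r) = f_D r.
Proof.
rewrite (card_gf_split (fun S => (m, o) \in S)).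
rewrite (card_gf_split (fun S => (o, m) \in S)) addrC.
transitivity (card_gf (@stair r 0 r) +
   (\sum_(0 <= p < n.+1) 'X^(r - p.+1 + r.-1) * card_gf (@stair r 1 p.+1)
    + 'X^(n.+1) * card_gf (@stair r 1 r))).
  congr (_ + (_ + _)).
  - apply: card_gf_ext => S; rewrite -abelian_upset_stair.
    by split=> -[vS h]; split=> //; apply/negP.
  - by rewrite -(card_gf_hooks m); apply: card_gf_ext => S; split=> [[[? ?] ?]|[? ? ?]].
  - rewrite -(@card_gf_stair_full r o m) // -[RHS](card_gf_involution _ swapK).
    apply: card_gf_ext => S; rewrite -swap_abelian_upset.
    by split=> [[[? ?] /negP ?]|[? ? /negP ?]].
have st a b : (a <= b <= r)%N ->
    card_gf (@stair r a b) = \prod_(1 <= j < b - a) (1 + 'X^j).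
  by move=> /andP[ab br]; rewrite -(@card_gf_stair r _ a) ?subnKC.
rewrite (st 0 r) ?leqnn // (st 1 r) ?leqnn // subn0 subn1 /f_D /=.
rewrite [LHS]addrC; congr (_ + _).
rewrite big_nat_recl // st // big_geq // mulr1 -addrA.
have -> : (r - 1 + r.-1 = 2 * r - 2)%N by lia.
congr (_ + _); rewrite [RHS]big_nat_recr //=; congr (_ + _); last first.
  by congr ('X^_ * _); lia.
apply: eq_big_nat => k /andP[_ kn]; rewrite st; last by lia.
by congr ('X^_ * _); lia.
Qed.
End Count.

(** * The count of abelian ideals *)

From mathcomp Require Import classical_sets functions cardinality reals.
From mathcomp Require Import complex.

(** Abelian ideals transported along the isomorphism [borel_emb P]. *)
Lemma abelian_ideal_borel_emb (K : numFieldType) r (P : 'M[K]_(r + r))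
    (V : {vspace 'M[K]_r}) :
    P *m P^T = polar_mx K r ->
  abelian_ideal (limg (linfun (borel_emb P))) (linfun (borel_emb P) @: V)
    <-> brk_ideal V.
Proof.
move=> PPT; set f := linfun (borel_emb P); pose finj := borel_emb_inj PPT.
have fE x : f x = borel_emb P x by rewrite lfunE.
have mem x : (borel_emb P x \in f @: V)%VS = (x \in V).
  apply/memv_imgP/idP => [[y yV]|xV]; last by exists x.
  by rewrite fE => /finj->.
split=> [[[_ /lie_subv I1] I2]|[I1 I2]].
  split=> x y => [yV|xV yV].
    rewrite -mem -borel_emb_brk //; apply: I1; rewrite ?mem //.
    by rewrite -fE memv_img ?memvf.
  apply: finj; rewrite -borel_emb_brk // [RHS]raddf0; apply/eqP.
  by rewrite -memv0 -I2 memv_lie ?mem.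
split; [split|].
- exact: limgS (subvf V).
- apply/lie_subv => _ _ /memv_imgP[x _ ->] /memv_imgP[y yV ->].
  by rewrite !fE borel_emb_brk // mem; apply: I1.
- apply/eqP; rewrite -subv0.
  apply/lie_subv => _ _ /memv_imgP[x xV ->] /memv_imgP[y yV ->].
  by rewrite !fE borel_emb_brk // I2 // [borel_emb P 0]raddf0 mem0v.
Qed.

Local Open Scope classical_set_scope.
Local Open Scope card_scope.

Lemma card_abelian_ideals (K : numClosedFieldType) (r : nat) (hr : (2 <= r)%N)
    (b : {vspace 'M[K]_(r + r)})
    (hb : borel_subalgebra (orthogonal_lie K (r + r)) b) (m : nat) :
  [set I : {vspace 'M[K]_(r + r)} | abelian_ideal b I /\ \dim I = m]
    #= `I_((f_D r)`_m)%R.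
Proof.
have [P PPT ->] := borel_conjugate hb.
pose f := linfun (borel_emb P).
have finj : injective f by move=> x y; rewrite !lfunE; apply: borel_emb_inj.
have f0 : lker f = 0%VS by apply/eqP/lker0P.
have mem (V : {vspace 'M[K]_r}) x : (f x \in f @: V)%VS = (x \in V).
  by apply/memv_imgP/idP => [[y yV /finj->]|xV]; last exists x.
pose F (S : {set 'I_r * 'I_r}) := (f @: root_span K S)%VS.
have Finj : injective F.
  move=> S S' FS; apply: (@root_span_inj K); apply/vspaceP => x.
  by rewrite -!mem -/(F S) FS.
have dimF S : \dim (F S) = #|S| by rewrite limg_dim_eq ?dim_root_span // f0 capv0.
pose G :=
  finset (fun S : {set 'I_r * 'I_r} => `[< abelian_upset S >] && (#|S| == m)).
have -> : (f_D r)`_m = #|G|.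
  rewrite -coef_card_gf; case: (r) hr => [|[|n]] // _.
  by rewrite card_gf_abelian_upset.
have -> : [set I | abelian_ideal (limg f) I /\ \dim I = m] =
    (fun i : 'I_#|G| => F (enum_val i)) @` [set: 'I_#|G|].
  apply/seteqP; split=> [I [aI dI]|_ [i _ <-]] /=.
    have /(abelian_ideal_borel_emb _ PPT) VI :
        abelian_ideal (limg f) (f @: (f @^-1: I)).
      by rewrite lpreimK //; case: aI => -[].
    have e : I = F (ideal_roots (f @^-1: I)%VS).
      by rewrite /F -(ideal_root_span hr VI) lpreimK //; case: aI => -[].
    have GI : ideal_roots (f @^-1: I)%VS \in G.
      rewrite inE -dimF -e dI eqxx andbT; apply/asboolP.
      exact: abelian_upset_ideal_roots hr VI.
    exists (enum_rank_in GI (ideal_roots (f @^-1: I)%VS)) => //.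
    by rewrite enum_rankK_in.
  have := enum_valP i; rewrite inE => /andP[/asboolP vS /eqP <-].
  rewrite dimF; split=> //; apply/abelian_ideal_borel_emb => //.
  exact: abelian_upset_brk_ideal.
apply: card_eq_trans (card_esym card_II).
by apply: inj_card_eq => i j _ _ /Finj/enum_val_inj.
Qed.

Unset Implicit Arguments.
Local Close Scope ring_scope.

Theorem proposition4p6 (R : realType) (r : nat) (hr : (4 <= r)%N)
    (b : {vspace 'M[complex R]_(2 * r)})
    (hb : borel_subalgebra (orthogonal_lie (complex R) (2 * r)) b) (m : nat) :
  [set I : {vspace 'M[complex R]_(2 * r)} | abelian_ideal b I /\ \dim I = m]
    #= `I_((f_D r)`_m)%R.
Proof.
have [N e] : {N | N = (2 * r)%N} by exists (2 * r)%N.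
move: b hb; rewrite -e; have {e} : N = (r + r)%N by rewrite e mul2n addnn.
move=> -> b hb; apply: card_abelian_ideals hb m.
exact: leq_trans hr.
Qed.
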